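(* Consider the problem of minimizing $\varphi(x):=\frac12\langle Ax,x\rangle+\langle b,x\rangle+\alpha+g(x)$ over $x\in\mathbb{R}^n$, where $A\in\mathbb{R}^{n\times n}$ is symmetric positive-definite, $b\in\mathbb{R}^n$, $\alpha\in\mathbb{R}$, and $g:\mathbb{R}^n\to(-\infty,\infty]$ is proper, lower semicontinuous and convex. Then: (i) the Generalized Damped Newton Algorithm for Quadratic Composite Optimization is well-defined, and its sequence of iterates $\{u^k\}$ globally converges at least R-linearly to some $\bar u$; (ii) $\bar x:=Q\bar u+c$ is a tilt-stable local minimizer of $\varphi$ and is the unique solution of the problem. Furthermore, the convergence of $\{u^k\}$ is at least Q-superlinear if the subgradient mapping $\partial g$ is semismooth$^*$ at $(\bar x,\bar v)$ with $\bar v:=-A\bar x-b$, and one of the following holds: (a) $\sigma\in(0,1/(2\ell\kappa))$ where $\ell:=1+\|Q\|$ and $\kappa:=1/\lambda_{\min}(P)$; (b) $g$ is twice epi-differentiable at $\bar x$ for $\bar v$.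
   Context: Moreau envelope and proximal map of $g$ with $\gamma>0$: $e_\gamma g(x):=\inf_y\{g(y)+\frac1{2\gamma}\|y-x\|^2\}$, $\operatorname{Prox}_{\gamma g}(x):=\operatorname{argmin}_y\{g(y)+\frac1{2\gamma}\|y-x\|^2\}$. Generalized Damped Newton Algorithm for Quadratic Composite Optimization: input $A,b,g$, $\sigma\in(0,\tfrac12)$, $\beta\in(0,1)$. Choose $\gamma>0$ with $I-\gamma A$ positive-definite; set $Q:=(I-\gamma A)^{-1}$, $c:=\gamma Qb$, $P:=Q-I$, and $\psi(u):=\frac12\langle Pu,u\rangle+\langle c,u\rangle+\gamma e_\gamma g(u)$ (so $\nabla\psi(u)=Qu-\operatorname{Prox}_{\gamma g}(u)+c$). Choose $u^0$, $k=0$. If $\nabla\psi(u^k)=0$ stop; else set $v^k:=\operatorname{Prox}_{\gamma g}(u^k)$ and find $d^k$ with $\frac1\gamma(-\nabla\psi(u^k)-Pd^k)\in\partial^2 g\big(v^k,\frac1\gamma(u^k-v^k)\big)(Qd^k+\nabla\psi(u^k))$; set $\tau_k=1$ and while $\psi(u^k+\tau_kd^k)>\psi(u^k)+\sigma\tau_k\langle\nabla\psi(u^k),d^k\rangle$ replace $\tau_k$ by $\beta\tau_k$; set $u^{k+1}:=u^k+\tau_kd^k$, increase $k$, repeat. Output $x^k:=Qu^k+c$. Here $\partial g$ is the convex subdifferential; for $(x,y)\in\operatorname{gph}\partial g$, $\partial^2g(x,y)(w):=\{z\mid (z,-w)\in N_{\operatorname{gph}\partial g}(x,y)\}$, where $N$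 is the limiting normal cone: $N_\Omega(\bar z)$ consists of $v$ with $z_k\to\bar z$, $z_k\in\Omega$, $v_k\to v$, $v_k\in\widehat N_\Omega(z_k)$, and $\widehat N_\Omega(\bar z):=\{v\mid \limsup_{z\to\bar z,z\in\Omega}\langle v,z-\bar z\rangle/\|z-\bar z\|\le0\}$. Semismooth$^*$: with $N_\Omega(\bar z;d):=\{v\mid\exists t_k\downarrow0,d_k\to d,v_k\to v,\ v_k\in\widehat N_\Omega(\bar z+t_kd_k)\}$ and $D^*F((\bar x,\bar y);(u,v))(v^* ):=\{u^*\mid(u^*,-v^* )\in N_{\operatorname{gph}F}((\bar x,\bar y);(u,v))\}$, $F$ is semismooth$^*$ at $(\bar x,\bar y)$ if for all $(u,v)$, $\langle u^*,u\rangle=\langle v^*,v\rangle$ whenever $u^*\in D^*F((\bar x,\bar y);(u,v))(v^* )$. Twice epi-differentiability: $g$ is twice epi-differentiable at $\bar x$ for $v$ if for every $w$ and every $\tau_k\downarrow0$ there is $w^k\to w$ with $\frac{g(\bar x+\tau_kw^k)-g(\bar x)-\tau_k\langle v,w^k\rangle}{\tau_k^2/2}\to d^2g(\bar x,v)(w)$, where $d^2g(\bar x,v)(w):=\liminf_{\tau\downarrow0,u\to w}\frac{g(\bar x+\tau u)-g(\bar x)-\tau\langle v,u\rangle}{\tau^2/2}$. Tilt stability: $\bar x$ is a tilt-stable local minimizer of $\varphi$ if for some $\gamma'>0$ the map $v\mapsto\operatorname{argmin}\{\varphi(x)-\langle v,x\rangle\mid x\in\mathbb{B}_{\gamma'}(\bar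 x)\}$ is single-valued and Lipschitz near $0$ with value $\{\bar x\}$ at $0$. R-linear convergence: $\|u^k-\bar u\|\le C\mu^k$ for some $C>0$, $\mu\in(0,1)$ and all large $k$; Q-superlinear: $\|u^{k+1}-\bar u\|/\|u^k-\bar u\|\to0$. *)

(* Defs.v *)
From HB Require Import structures.
From mathcomp Require Import all_boot all_order all_algebra.
From mathcomp Require Import all_classical all_reals all_analysis.
Set Implicit Arguments. Unset Strict Implicit. Unset Printing Implicit Defensive.
Import Order.TTheory GRing.Theory Num.Theory.
Local Open Scope classical_set_scope.
Local Open Scope ring_scope.

Section Defs.
Variable R : realType.
Variable n : nat.
Notation vec := 'cV[R]_n.
Notation mat := 'M[R]_n.

Definition dot (u v : vec) : R := \sum_(i < n) u i 0 * v i 0.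
Definition enorm (u : vec) : R := Num.sqrt (dot u u).

Definition pdot (a b : vec * vec) : R := dot a.1 b.1 + dot a.2 b.2.
Definition pnorm (a : vec * vec) : R := Num.sqrt (pdot a a).
Definition padd (a b : vec * vec) : vec * vec := (a.1 + b.1, a.2 + b.2).
Definition psub (a b : vec * vec) : vec * vec := (a.1 - b.1, a.2 - b.2).
Definition pscale (t : R) (a : vec * vec) : vec * vec := (t *: a.1, t *: a.2).

Definition vcvg (s : nat -> vec) (l : vec) : Prop :=
  forall e : R, 0 < e -> exists N : nat, forall k, (N <= k)%N -> enorm (s k - l) < e.
Definition pcvg (s : nat -> vec * vec) (l : vec * vec) : Prop :=
  forall e : R, 0 < e -> exists N : nat, forall k, (N <= k)%N -> pnorm (psub (s k) l) < e.
Definition rcvg (s : nat -> R) (l : R) : Prop :=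
  forall e : R, 0 < e -> exists N : nat, forall k, (N <= k)%N -> `|s k - l| < e.
Definition down0 (t : nat -> R) : Prop := (forall k, 0 < t k) /\ rcvg t 0.

Definition sym_mx (M : mat) : Prop := M^T = M.
Definition posdef (M : mat) : Prop := forall x : vec, x != 0 -> 0 < dot (M *m x) x.
Definition opnorm (M : mat) : R := sup [set enorm (M *m x) | x in [set x : vec | enorm x <= 1]].
(* smallest eigenvalue (of a symmetric matrix: all eigenvalues are real) *)
Definition lambda_min (M : mat) : R :=
  inf [set l : R | exists x : vec, x != 0 /\ M *m x = l *: x].

Definition proper_fun (g : vec -> \bar R) : Prop :=
  (exists x, g x \is a fin_num) /\ (forall x, g x != -oo%E).
Definition lsc_fun (g : vec -> \bar R) : Prop :=
  forall (x : vec) (t : R), (t%:E < g x)%E ->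
    exists d : R, 0 < d /\ forall y, enorm (y - x) < d -> (t%:E < g y)%E.
Definition convex_fun (g : vec -> \bar R) : Prop :=
  forall (x y : vec) (l : R), 0 < l < 1 ->
    (g (l *: x + (1 - l) *: y)%R <= l%:E * g x + (1 - l)%R%:E * g y)%E.

Definition subdiff (g : vec -> \bar R) (x : vec) : set vec :=
  [set v | g x \is a fin_num /\ forall y, (g x + (dot v (y - x))%:E <= g y)%E].
Definition gph_subdiff (g : vec -> \bar R) : set (vec * vec) :=
  [set z | subdiff g z.1 z.2].

Definition moreau (g : vec -> \bar R) (gam : R) (x : vec) : \bar R :=
  ereal_inf [set (g y + (1 / (2 * gam) * enorm (y - x) ^+ 2)%:E)%E | y in [set: vec]].
Definition prox (g : vec -> \bar R) (gam : R) (x : vec) : set vec :=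
  [set v | forall y, (g v + (1 / (2 * gam) * enorm (v - x) ^+ 2)%:E
                       <= g y + (1 / (2 * gam) * enorm (y - x) ^+ 2)%:E)%E].

Definition rnormal (Om : set (vec * vec)) (zb : vec * vec) : set (vec * vec) :=
  [set v | Om zb /\
    forall e : R, 0 < e -> exists d : R, 0 < d /\
      forall z, Om z -> 0 < pnorm (psub z zb) < d ->
        pdot v (psub z zb) <= e * pnorm (psub z zb)].
Definition lnormal (Om : set (vec * vec)) (zb : vec * vec) : set (vec * vec) :=
  [set v | exists (z w : nat -> vec * vec),
     (forall k, Om (z k)) /\ pcvg z zb /\ pcvg w v /\ (forall k, rnormal Om (z k) (w k))].
Definition dnormal (Om : set (vec * vec)) (zb d : vec * vec) : set (vec * vec) :=
  [set v | exists (t : nat -> R) (dk w : nat -> vec * vec),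
     down0 t /\ pcvg dk d /\ pcvg w v /\
     (forall k, rnormal Om (padd zb (pscale (t k) (dk k))) (w k))].

Definition subdiff2 (g : vec -> \bar R) (x y w : vec) : set vec :=
  [set z | lnormal (gph_subdiff g) (x, y) (z, - w)].

Definition semismooth_star_subdiff (g : vec -> \bar R) (xb yb : vec) : Prop :=
  forall (u v us vs : vec),
    dnormal (gph_subdiff g) (xb, yb) (u, v) (us, - vs) -> dot us u = dot vs v.

Definition sdq (g : vec -> \bar R) (xb v : vec) (t : R) (u : vec) : \bar R :=
  ((g (xb + t *: u)%R - g xb - (t * dot v u)%:E) * (2 / (t ^+ 2))%:E)%E.
Definition subderiv2 (g : vec -> \bar R) (xb v w : vec) : \bar R :=
  ereal_sup [set ereal_inf [set sdq g xb v t u | t in [set t : R | 0 < t < d] &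
                                                 u in [set u | enorm (u - w) < d]]
            | d in [set d : R | 0 < d]].
Definition twice_epi_diff (g : vec -> \bar R) (xb v : vec) : Prop :=
  forall (w : vec) (t : nat -> R), down0 t ->
    exists wk : nat -> vec, vcvg wk w /\
      (fun k => sdq g xb v (t k) (wk k)) @ \oo --> subderiv2 g xb v w.

Definition closed_ball (xb : vec) (r : R) : set vec := [set x | enorm (x - xb) <= r].
Definition argmin_ball (phi : vec -> \bar R) (xb : vec) (r : R) (v : vec) : set vec :=
  [set x | closed_ball xb r x /\
     forall y, closed_ball xb r y -> (phi x - (dot v x)%:E <= phi y - (dot v y)%:E)%E].
Definition tilt_stable (phi : vec -> \bar R) (xb : vec) : Prop :=
  exists (r : R), 0 < r /\
  exists (d L : R) (m : vec -> vec), 0 < d /\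
    (forall v, enorm v < d -> argmin_ball phi xb r v = [set m v]) /\
    (forall v1 v2, enorm v1 < d -> enorm v2 < d ->
        enorm (m v1 - m v2) <= L * enorm (v1 - v2)) /\
    m 0 = xb.

Definition R_linear (u : nat -> vec) (ub : vec) : Prop :=
  exists (C mu : R), 0 < C /\ 0 < mu < 1 /\
    exists N : nat, forall k, (N <= k)%N -> enorm (u k - ub) <= C * mu ^+ k.
Definition Q_superlinear (u : nat -> vec) (ub : vec) : Prop :=
  rcvg (fun k => enorm (u k.+1 - ub) / enorm (u k - ub)) 0.

Section Problem.
Variables (A : mat) (b : vec) (alpha : R) (g : vec -> \bar R).
Variables (gam sigma beta : R).

Definition phi (x : vec) : \bar R :=
  (((1 / 2) * dot (A *m x) x + dot b x + alpha)%:E + g x)%E.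

Definition Qm : mat := invmx (1%:M - gam *: A).
Definition cv : vec := gam *: (Qm *m b).
Definition Pm : mat := Qm - 1%:M.

Definition psi (u : vec) : \bar R :=
  (((1 / 2) * dot (Pm *m u) u + dot cv u)%:E + gam%:E * moreau g gam u)%E.
(* gradient of psi, given v = Prox_{gam g}(u) *)
Definition grad_psi (u v : vec) : vec := Qm *m u - v + cv.

Definition newton_dir (u v d : vec) : Prop :=
  subdiff2 g v (gam^-1 *: (u - v)) (Qm *m d + grad_psi u v)
    (gam^-1 *: (- grad_psi u v - Pm *m d)).
Definition armijo (u v d : vec) (j : nat) : Prop :=
  (psi (u + beta ^+ j *: d)%R <= psi u + (sigma * beta ^+ j * dot (grad_psi u v) d)%:E)%E.

(* one iteration u -> u' of the algorithm (if the stopping test holds,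
   the algorithm stops, modelled by u' = u) *)
Definition gdna_step (u u' : vec) : Prop :=
  exists v, prox g gam u v /\
   ((grad_psi u v = 0 /\ u' = u) \/
    (grad_psi u v != 0 /\ exists (d : vec) (j : nat),
        newton_dir u v d /\ armijo u v d j /\ (forall i, (i < j)%N -> ~ armijo u v d i) /\
        u' = u + beta ^+ j *: d)).
Definition gdna_seq (u : nat -> vec) : Prop := forall k, gdna_step (u k) (u k.+1).

End Problem.
End Defs.

(* Main.v *)
Require Import Defs.
From HB Require Import structures.
From mathcomp Require Import all_boot all_order all_algebra.
From mathcomp Require Import all_classical all_reals all_analysis.
From mathcomp Require Import ring lra.
Import Order.TTheory GRing.Theory Num.Theory.
Import numFieldNormedType.Exports.
Set Implicit Arguments. Unset Strict Implicit. Unset Printing Implicit Defensive.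
Local Open Scope classical_set_scope.
Local Open Scope ring_scope.

(** The gradient [F u = Q u - Prox u + c] of [psi] is Lipschitz and strongly
    monotone, and the linear parametrisation [u |-> (Prox u, (u - Prox u) / gam)]
    of the graph of [subdiff g] turns the Newton inclusion into
    [- F u \in D^*F(u)(d)].  Coderivative elements [w \in D^*F(x)(y)] satisfy
    [lam |y|^2 <= <w, y>] and [|w| <= L |y|], so [d] is a descent direction of
    size comparable to [F u]; the Armijo steps are bounded below and
    [psi (u k) - min psi] decreases geometrically.

    For the superlinear rate, put [e = ub - u - d].  Symmetry of generalised
    Hessians (proved by mean value arguments, without Rademacher's theorem) gives
    [z \in D^*F(u)(e)] with [<z, d> >= <- F u, e>]; semismoothness* gives
    [<z, u - ub> = <e, F u> + o(|u - ub| |e|)], whence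
    [lam |e|^2 <= <z, e> <= o(|u - ub| |e|)].  Semismoothness* also yields
    [psi u - psi ub >= 1/2 <F u, u - ub> - o(|u - ub|^2)], so the unit step
    eventually passes the Armijo test for every [sigma < 1/2]. *)

(** Symmetry is needed because the Newton inclusion is attached to the argument [d]. Testing
    semismoothness* on [- F u \in D^*F(u)(d)] itself only gives [<F u, e> = o(|u - ub| |d|)], that
    is, one component of the error, whereas the lower bound [lam |y|^2 <= <w, y>] has to be applied
    at [y = e]. For this transfer from [d] to [e] the one-sided inequality [<z, d> >= <- F u, e>]
    suffices.

    Elements of the regular coderivative are constructed variationally: if [x] locally minimises
    [<y, F> - <w, .>] up to a quadratic error around [x], then the minimality inequality is the one
    that defines [w \in D^*F(x)(y)]. Quadratic penalties keep the minimisers over compact sets where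
    the perturbations of interest are admissible; limiting elements follow by compactness.

    Smoothness of [psi] is encoded by a lower and an upper quadratic bound at each point, with
    moduli [lam] and [L]. Their ratio governs both the lower bound on Armijo steps and the
    contraction factor of the values. *)

Section InnerProduct.
Variables (R : realType) (n : nat).
Notation vec := 'cV[R]_n.
Implicit Types (x y z : vec) (a : R).

Lemma dotC x y : dot x y = dot y x.
Proof. by apply: eq_bigr => i _; rewrite mulrC. Qed.

Lemma dotDl x y z : dot (x + y) z = dot x z + dot y z.
Proof. by rewrite -big_split; apply: eq_bigr => i _; rewrite mxE mulrDl. Qed.

Lemma dotZl a x y : dot (a *: x) y = a * dot x y.
Proof. by rewrite /dot mulr_sumr; apply: eq_bigr => i _; rewrite mxE mulrA. Qed.

Lemma dotNl x y : dot (- x) y = - dot x y.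
Proof. by rewrite -scaleN1r dotZl mulN1r. Qed.

Lemma dotDr x y z : dot x (y + z) = dot x y + dot x z.
Proof. by rewrite dotC dotDl !(dotC x). Qed.

Lemma dotZr a x y : dot x (a *: y) = a * dot x y.
Proof. by rewrite dotC dotZl dotC. Qed.

Lemma dotNr x y : dot x (- y) = - dot x y.
Proof. by rewrite dotC dotNl dotC. Qed.

Lemma dot0l x : dot 0 x = 0.
Proof. by rewrite -(scale0r 0) dotZl mul0r. Qed.

Lemma dot0r x : dot x 0 = 0.
Proof. by rewrite dotC dot0l. Qed.

Definition dotE := (dotDl, dotDr, dotNl, dotNr, dotZl, dotZr).

Lemma dot_mulmxl (M : 'M[R]_n) x y : dot (M *m x) y = dot x (M^T *m y).
Proof.
rewrite /dot; under eq_bigr do rewrite mxE mulr_suml.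
under [RHS]eq_bigr do rewrite mxE mulr_sumr.
rewrite exchange_big; apply: eq_bigr => i _; apply: eq_bigr => j _.
by rewrite !mxE; ring.
Qed.

Lemma dot_ge0 x : 0 <= dot x x.
Proof. by apply: sumr_ge0 => i _; rewrite -expr2 sqr_ge0. Qed.

Lemma dot_eq0 x : dot x x = 0 -> x = 0.
Proof.
move/eqP; rewrite psumr_eq0; last by move=> i _; rewrite -expr2 sqr_ge0.
move/allP => h; apply/matrixP => i j; rewrite ord1 mxE; apply/eqP.
by have := h i (mem_index_enum i); rewrite mulf_eq0 orbb.
Qed.

Lemma enorm_ge0 x : 0 <= enorm x.
Proof. exact: sqrtr_ge0. Qed.

Lemma enorm_sqr x : enorm x ^+ 2 = dot x x.
Proof. by rewrite sqr_sqrtr ?dot_ge0. Qed.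

Lemma enorm_le x a : 0 <= a -> dot x x <= a ^+ 2 -> enorm x <= a.
Proof. by move=> a0; rewrite -enorm_sqr ler_pXn2r ?nnegrE ?enorm_ge0. Qed.

Lemma enorm_lt x a : 0 <= a -> dot x x < a ^+ 2 -> enorm x < a.
Proof. by move=> a0; rewrite -enorm_sqr ltr_pXn2r ?nnegrE ?enorm_ge0. Qed.

Lemma enorm0 : enorm (0 : vec) = 0.
Proof. by rewrite /enorm dot0l sqrtr0. Qed.

Lemma enorm_eq0 x : enorm x = 0 -> x = 0.
Proof. by move=> h; apply: dot_eq0; rewrite -enorm_sqr h expr0n. Qed.

Lemma enorm_gt0 x : x != 0 -> 0 < enorm x.
Proof.
move=> x0; rewrite lt_def enorm_ge0 andbT; apply: contra x0 => /eqP h.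
by rewrite (enorm_eq0 h).
Qed.

Lemma enormZ a x : enorm (a *: x) = `|a| * enorm x.
Proof.
by rewrite /enorm dotZl dotZr mulrA -expr2 sqrtrM ?sqr_ge0 // sqrtr_sqr.
Qed.

Lemma enormN x : enorm (- x) = enorm x.
Proof. by rewrite -scaleN1r enormZ normrN normr1 mul1r. Qed.

Lemma enorm_distC x y : enorm (x - y) = enorm (y - x).
Proof. by rewrite -enormN opprB. Qed.

Lemma dot_sqr_le x y : dot x y ^+ 2 <= dot x x * dot y y.
Proof.
have [y0|] := eqVneq y 0; first by rewrite y0 !dot0r mulr0 expr0n.
move/enorm_gt0 => /(exprn_gt0 2); rewrite enorm_sqr => y0.
have := dot_ge0 (dot y y *: x - dot x y *: y).
rewrite !dotE (dotC y x).
rewrite (_ : _ + _ = dot y y * (dot x x * dot y y - dot x y ^+ 2)); last by ring.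
by rewrite pmulr_rge0 // subr_ge0.
Qed.

Lemma dot_abs_le x y : `|dot x y| <= enorm x * enorm y.
Proof.
rewrite -ler_sqr ?nnegrE ?mulr_ge0 ?enorm_ge0 //.
by rewrite real_normK ?num_real // exprMn !enorm_sqr dot_sqr_le.
Qed.

Lemma dot_le x y : dot x y <= enorm x * enorm y.
Proof. exact: le_trans (ler_norm _) (dot_abs_le _ _). Qed.

Lemma dot_ge x y : - (enorm x * enorm y) <= dot x y.
Proof. by have := dot_abs_le x y; rewrite ler_norml => /andP[]. Qed.

Lemma enormD x y : enorm (x + y) <= enorm x + enorm y.
Proof.
apply: enorm_le; first by rewrite addr_ge0 ?enorm_ge0.
rewrite !dotE sqrrD !enorm_sqr (dotC y x).
by have := dot_le x y; lra.
Qed.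

Lemma enorm_distD z x y : enorm (x - y) <= enorm (x - z) + enorm (z - y).
Proof. by rewrite -{1}(subrKA z) enormD. Qed.

Lemma enorm_dist_le x y : `|enorm x - enorm y| <= enorm (x - y).
Proof.
rewrite ler_norml; have := enormD (x - y) y; have := enormD (y - x) x.
by rewrite !subrK enorm_distC; lra.
Qed.

Lemma enorm_entry x i : `|x i 0| <= enorm x.
Proof.
rewrite -ler_sqr ?nnegrE ?enorm_ge0 // enorm_sqr real_normK ?num_real //.
rewrite /dot (bigD1 i) //= -expr2 lerDl.
by apply: sumr_ge0 => j _; rewrite -expr2 sqr_ge0.
Qed.

(** The crude factor [n.+1%:R] keeps the inequality strict when [n = 0]. *)
Lemma enorm_lt_entries x a : 0 < a -> (forall i, `|x i 0| < a) ->
  enorm x < n.+1%:R * a.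
Proof.
move=> a0 h; apply: enorm_lt; first by rewrite mulr_ge0 // ltW.
apply: (@le_lt_trans _ _ (n%:R * a ^+ 2)).
  rewrite /dot (le_trans (y := \sum_(i < n) a ^+ 2)) //.
    apply: ler_sum => i _; rewrite -expr2 -real_normK ?num_real //.
    by rewrite ler_pXn2r ?nnegrE // ?ltW // h.
  by rewrite sumr_const card_ord mulr_natl.
rewrite exprMn ltr_pM2r ?exprn_gt0 // -natrX ltr_nat.
by rewrite (leq_trans (ltnSn n)) // expnS expn1 leq_pmulr.
Qed.

Lemma mulmx_bound (M : 'M[R]_n) :
  exists2 C : R, 0 < C & forall x, enorm (M *m x) <= C * enorm x.
Proof.
(* The summand [1] makes [B] positive and strictly larger than every absolute row sum, also for the
   zero matrix. *)
pose B := \sum_(i < n) \sum_(j < n) `|M i j| + 1.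
have B0 : 0 < B.
  by rewrite ltr_wpDl // sumr_ge0 // => i _; apply: sumr_ge0.
exists (n.+1%:R * B); first by rewrite mulr_gt0.
move=> x; have [->|x0] := eqVneq x 0; first by rewrite mulmx0 enorm0 mulr0.
have ex := enorm_gt0 x0.
rewrite -mulrA ltW // enorm_lt_entries ?mulr_gt0 // => i.
rewrite mxE; apply: (@le_lt_trans _ _ (\sum_j `|M i j| * enorm x)).
  apply: le_trans (ler_norm_sum _ _ _) _; apply: ler_sum => j _.
  by rewrite normrM ler_wpM2l // enorm_entry.
rewrite -mulr_suml ltr_pM2r // /B [ltRHS](_ : _ = \sum_j `|M i j| +
    (\sum_(k < n | k != i) \sum_j `|M k j| + 1)); last first.
  by rewrite (bigD1 i) //= addrA.
rewrite ltrDl.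
by rewrite ltr_wpDl // sumr_ge0 // => k _; apply: sumr_ge0.
Qed.

End InnerProduct.

(** * Sequential convergence and compactness in Euclidean space *)

Section Convergence.
Variables (R : realType) (n : nat).
Notation vec := 'cV[R]_n.
Implicit Types (s r : nat -> vec) (l m : vec).

Lemma vcvgP s l : vcvg s l <-> (fun k => enorm (s k - l)) @ \oo --> (0 : R).
Proof.
split=> [h|h e e0].
  apply/cvgrPdist_lt => e e0; have [N hN] := h _ e0; exists N => // k /= Nk.
  by rewrite sub0r normrN ger0_norm ?enorm_ge0 ?hN.
move/cvgrPdist_lt : h => /(_ _ e0)[N _ hN]; exists N => k Nk.
by have := hN k Nk; rewrite /= sub0r normrN ger0_norm ?enorm_ge0.
Qed.

Lemma rcvgP (s : nat -> R) (l : R) : rcvg s l <-> s @ \oo --> l.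
Proof.
split=> [h|h e e0].
  apply/cvgrPdist_lt => e e0; have [N hN] := h _ e0; exists N => // k /= Nk.
  by rewrite distrC hN.
move/cvgrPdist_lt : h => /(_ _ e0)[N _ hN]; exists N => k Nk.
by rewrite distrC; exact: hN.
Qed.

Lemma vcvg_le s l (t : nat -> R) :
  (forall k, enorm (s k - l) <= t k) -> t @ \oo --> (0 : R) -> vcvg s l.
Proof.
move=> st t0; apply/vcvgP; apply: (squeeze_cvgr _ (cvg_cst 0) t0).
by apply: nearW => k; rewrite enorm_ge0 st.
Qed.

Lemma vcvg_cst l : vcvg (fun=> l) l.
Proof. by move=> e e0; exists 0%N => k _; rewrite subrr enorm0. Qed.

Lemma vcvgD s r l m : vcvg s l -> vcvg r m -> vcvg (fun k => s k + r k) (l + m).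
Proof.
move=> /vcvgP sl /vcvgP rm.
apply: (@vcvg_le _ _ (fun k => enorm (s k - l) + enorm (r k - m))).
  by move=> k; rewrite opprD addrACA enormD.
by rewrite -(addr0 0); apply: cvgD.
Qed.

Lemma vcvgZ (t : nat -> R) (a : R) s l : t @ \oo --> a -> vcvg s l ->
  vcvg (fun k => t k *: s k) (a *: l).
Proof.
move=> ta /vcvgP sl.
apply: (@vcvg_le _ _ (fun k => `|t k| * enorm (s k - l) + `|t k - a| * enorm l)).
  move=> k; rewrite -!enormZ (le_trans _ (enormD _ _)) // scalerBr scalerBl.
  by rewrite addrA subrK.
rewrite -(addr0 0); apply: cvgD.
  by rewrite -(mulr0 `|a|); apply: cvgM => //; exact: cvg_norm.
rewrite -(mul0r (enorm l)); apply: cvgM; last exact: cvg_cst.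
rewrite -(normr0 R); apply: cvg_norm; rewrite -(subrr a).
by apply: cvgB => //; exact: cvg_cst.
Qed.

Lemma vcvgN s l : vcvg s l -> vcvg (fun k => - s k) (- l).
Proof. by move=> sl e /sl[N h]; exists N => k /h; rewrite -opprD enormN. Qed.

Lemma vcvg_lip (G : vec -> vec) (C : R) s l :
  (forall x y, enorm (G x - G y) <= C * enorm (x - y)) ->
  vcvg s l -> vcvg (G \o s) (G l).
Proof.
move=> GC /vcvgP sl; apply: (vcvg_le (fun k => GC (s k) l)).
by rewrite -(mulr0 C); apply: cvgM => //; exact: cvg_cst.
Qed.

Lemma vcvg_mulmx (M : 'M[R]_n) s l : vcvg s l -> vcvg (fun k => M *m s k) (M *m l).
Proof.
have [C _ hC] := mulmx_bound M; apply: (@vcvg_lip (mulmx M) C) => x y.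
by rewrite -mulmxBr hC.
Qed.

Lemma dot_cvg s r l m : vcvg s l -> vcvg r m ->
  (fun k => dot (s k) (r k)) @ \oo --> dot l m.
Proof.
move=> /vcvgP sl /vcvgP rm.
apply: (@cvg_sub0 _ _ _ _ _ _ (fun=> dot l m)); last exact: cvg_cst.
apply/cvgr0Pnorm_le.
have h : (fun k => enorm (s k - l) * enorm (r k - m) + enorm l * enorm (r k - m)
    + enorm (s k - l) * enorm m) @ \oo --> (0 : R).
  rewrite (_ : 0 = 0 * 0 + enorm l * 0 + 0 * enorm m); last by ring.
  by apply: cvgD; [apply: cvgD|]; apply: cvgM => //; exact: cvg_cst.
move=> e e0; move/cvgr0Pnorm_le : h => /(_ _ e0).
apply: filterS => k /=; apply: le_trans; rewrite [leRHS]ger0_norm; last first.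
  by rewrite !addr_ge0 ?mulr_ge0 ?enorm_ge0.
rewrite [X in `|X| <= _](_ : _ =
    dot (s k - l) (r k - m) + dot l (r k - m) + dot (s k - l) m); last first.
  rewrite -[LHS]/(dot (s k) (r k) - dot l m) !dotE.
  by ring.
apply: le_trans (ler_normD _ _) (lerD _ (dot_abs_le _ _)).
exact: le_trans (ler_normD _ _) (lerD (dot_abs_le _ _) (dot_abs_le _ _)).
Qed.

Lemma vcvg_enorm s l : vcvg s l -> (fun k => enorm (s k)) @ \oo --> enorm l.
Proof.
move=> sl; apply/rcvgP => e /sl[N h]; exists N => k /h.
exact: le_lt_trans (enorm_dist_le _ _).
Qed.

Lemma vcvg_sub s l (f : nat -> nat) : (forall k, (k <= f k)%N) -> vcvg s l ->
  vcvg (s \o f) l.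
Proof.
by move=> kf sl e /sl[N h]; exists N => k Nk; apply: h; exact: leq_trans (kf k).
Qed.

(** Compactness of a box of row vectors, carried over by transposition; entrywise balls of radius
    [e / n.+1%:R] lie in Euclidean balls of radius [e]. *)
Lemma bounded_cluster s (M : R) : (forall k, enorm (s k) <= M) ->
  exists l, forall e : R, 0 < e -> forall N, exists2 k, (N <= k)%N & enorm (s k - l) < e.
Proof.
move=> sM; pose K := [set v : 'rV[R]_n | forall i, `[- M, M]%classic (v ord0 i)].
have Kc : compact K.
  by apply: (@rV_compact R n (fun=> `[- M, M]%classic)) => i; exact: segment_compact.
pose F := (fun k => (s k)^T) @ \oo.
have FK : F K.
  exists 0%N => // k _ i /=; rewrite mxE in_itv /= -ler_norml.
  exact: le_trans (enorm_entry _ _) (sM k).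
have [v [_ cv]] := Kc F _ FK.
exists v^T => e e0 N.
pose A := [set (s k)^T | k in [set k | (N <= k)%N]].
pose B := [set v' : 'rV[R]_n | enorm (v'^T - v^T) < e].
have FA : F A by exists N => // k Nk; exists k.
have nB : nbhs v B.
  apply/nbhs_ballP; exists (e / n.+1%:R) => /=; first by rewrite divr_gt0.
  move=> v' [_ vv']; rewrite /B /=.
  rewrite (_ : e = n.+1%:R * (e / n.+1%:R)); last by rewrite mulrC divfK.
  apply: enorm_lt_entries; first by rewrite divr_gt0.
  by move=> i; rewrite !mxE distrC; exact: vv'.
have [_ [[k Nk <-] hk]] := cv A B FA nB.
by exists k => //; move: hk; rewrite /B /= trmxK.
Qed.

(** [f] is not asked to be monotone: [k <= f k] is enough to inherit limits and is stable under
    composition. *)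
Lemma bounded_subseq s (M : R) : (forall k, enorm (s k) <= M) ->
  exists f l, (forall k, (k <= f k)%N) /\ vcvg (s \o f) l.
Proof.
move=> sM; have [l hl] := bounded_cluster sM.
have hk (k : nat) : exists j, (k <= j)%N /\ enorm (s j - l) <= k.+1%:R^-1.
  have k0 : 0 < k.+1%:R^-1 :> R by rewrite invr_gt0.
  by have [j kj /ltW sj] := hl _ k0 k; exists j.
have [f hf] := choice hk; exists f, l; split=> [k|]; first by have [] := hf k.
by apply: (vcvg_le (t := harmonic)) (@cvg_harmonic R) => k; exact: (hf k).2.
Qed.

Lemma lte_real_between (x y : \bar R) : (x < y)%E ->
  exists2 a : R, (x < a%:E)%E & (a%:E < y)%E.
Proof.
case: x y => [r| |] [r'| |] //; rewrite ?lte_fin => rr'.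
- by exists ((r + r') / 2); rewrite lte_fin; lra.
- by exists (r + 1); rewrite ?lte_fin ?ltry //; lra.
- by exists (r' - 1); rewrite ?lte_fin ?ltNyr //; lra.
- by exists 0; rewrite ?ltry ?ltNyr.
Qed.

(* Sequential form of the Weierstrass theorem; [T] is left abstract so that it
   applies to pairs of a vector and a number as well. *)
Lemma exists_min (T : Type) (C : set T) (h : T -> \bar R) :
  C !=set0 -> (forall x, h x != -oo%E) ->
  (forall s : nat -> T, (forall k, C (s k)) -> exists2 l, C l &
     forall t : R, (t%:E < h l)%E -> forall N, exists2 k, (N <= k)%N & (t%:E < h (s k))%E) ->
  exists2 x, C x & forall y, C y -> (h x <= h y)%E.
Proof.
move=> [x0 Cx0] hoo hC; pose m := ereal_inf [set h x | x in C].
suff [x Cx hx] : exists2 x, C x & (h x <= m)%E.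
  by exists x => // y Cy; apply: le_trans hx _; apply: ereal_inf_lbound; exists y.
(* Levels descending to the infimum [m], for [m] real or [-oo]; if [m = +oo], every point of [C] is
   minimal. *)
have [t tm] : exists t : nat -> \bar R, [/\ (forall k, (m < t k)%E \/ m = +oo%E) &
    forall a : R, (m < a%:E)%E -> exists N, forall k, (N <= k)%N -> (t k <= a%:E)%E].
  case: m => [r| |].
  - exists (fun k => (r + k.+1%:R^-1)%:E); split=> [k|a].
      by left; rewrite lte_fin ltrDl invr_gt0.
    rewrite lte_fin -subr_gt0 => ra; have := @cvg_harmonic R.
    move/cvgr0Pnorm_le => /(_ _ ra)[N _ hN]; exists N => k Nk.
    have : k.+1%:R^-1 <= a - r.
      by rewrite -[leLHS]ger0_norm ?invr_ge0 //; exact: hN.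
    by rewrite lee_fin lerBrDl.
  - by exists (fun=> 0%E); split=> [k|a]; [right|].
  - exists (fun k => (- k%:R)%:E); split=> [k|a _].
      by left; rewrite ltNyr.
    have [N Na] : exists N : nat, - a <= N%:R.
      exists (Num.bound `|a|); apply: le_trans (ltW (archi_boundP (normr_ge0 a))).
      by rewrite -normrN ler_norm.
    exists N => k Nk; rewrite lee_fin lerNl (le_trans Na) // ler_nat //.
case: tm => tm ta.
have [mE|moo] := eqVneq m +oo%E; first by exists x0 => //; rewrite mE leey.
have hk k : exists x, C x /\ (h x < t k)%E.
  have [/ereal_inf_lt[_ [x Cx <-] hx]|mE] := tm k; first by exists x.
  by rewrite mE eqxx in moo.
have [s hs] := choice hk.
have [l Cl hl] := hC s (fun k => (hs k).1).
exists l => //; rewrite leNgt; apply/negP => ml.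
have [a ma al] := lte_real_between ml.
have [N hN] := ta _ ma.
have [k Nk hk'] := hl _ al N.
by have := lt_trans (lt_le_trans (hs k).2 (hN k Nk)) hk'; rewrite ltxx.
Qed.

End Convergence.

(** * Existence of minimisers on balls and on products of a ball with an interval *)

Section Minima.
Variables (R : realType) (n : nat).
Notation vec := 'cV[R]_n.

Lemma lsc_min_ball (h : vec -> \bar R) (a : vec) (r : R) :
  0 <= r -> (forall x, h x != -oo%E) -> lsc_fun h ->
  exists2 x, enorm (x - a) <= r & forall y, enorm (y - a) <= r -> (h x <= h y)%E.
Proof.
move=> r0 hoo hl; apply: (@exists_min R vec [set x | enorm (x - a) <= r]) => //.
  by exists a; rewrite /= subrr enorm0.
move=> s sr; have [|l sl] := @bounded_cluster R n s (r + enorm a).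
  move=> k; rewrite -(subrK a (s k)).
  exact: le_trans (enormD _ _) (lerD (sr k) (lexx _)).
exists l => [/=|t tl N].
  apply/ler_addgt0Pr => e /sl/(_ 0%N)[k _]; have := sr k; rewrite /=.
  by have := enorm_distD (s k) l a; rewrite (enorm_distC l (s k)); lra.
have [d [d0 hd]] := hl _ _ tl; have [k Nk kd] := sl _ d0 N.
by exists k => //; exact: hd.
Qed.

Lemma continuous_min_ball (h : vec -> R) (a : vec) (r : R) :
  0 <= r -> (forall s l, vcvg s l -> h \o s @ \oo --> h l) ->
  exists2 x, enorm (x - a) <= r & forall y, enorm (y - a) <= r -> h x <= h y.
Proof.
move=> r0 hc; have [//||x xr hx] := @lsc_min_ball (EFin \o h) a r r0.
  move=> x t /=; rewrite lte_fin => tx; apply: contrapT => hd.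
  have hk (k : nat) : exists y, enorm (y - x) <= k.+1%:R^-1 /\ h y <= t.
    apply: contrapT => hy; apply: hd; exists k.+1%:R^-1; split; first by rewrite invr_gt0.
    move=> y xy; rewrite lte_fin ltNge; apply/negP => yt; apply: hy.
    by exists y; rewrite (ltW xy).
  have [s hs] := choice hk.
  have sx : vcvg s x.
    by apply: (vcvg_le (t := harmonic)) (@cvg_harmonic R) => k; exact: (hs k).1.
  have /rcvgP/(_ (h x - t)) := hc _ _ sx; rewrite subr_gt0 => /(_ tx)[N hN].
  have := hN N (leqnn N); rewrite /= distrC; have := ler_norm (h x - h (s N)).
  by have := (hs N).2; lra.
by exists x => // y yr; rewrite -lee_fin; exact: hx.
Qed.

(** Serves the penalised problems below: the number is a position on a segment, the vector a
    displacement away from it. *)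
Lemma continuous_min_cylinder (h : vec -> R -> R) (r c : R) :
  0 <= r -> 0 <= c ->
  (forall s t l a, vcvg s l -> t @ \oo --> a ->
     (fun k => h (s k) (t k)) @ \oo --> h l a) ->
  exists x t, [/\ enorm x <= r, 0 <= t <= c &
    forall y a, enorm y <= r -> 0 <= a <= c -> h x t <= h y a].
Proof.
move=> r0 c0 hc.
pose C : set (vec * R) := [set z | enorm z.1 <= r /\ 0 <= z.2 <= c].
have [||s hs|[x t] [xr tc] hx] := @exists_min R _ C (fun z => (h z.1 z.2)%:E) _ _.
- by exists (0, 0); split => /=; rewrite ?enorm0 ?lexx.
- by [].
- have [f [l [ff fl]]] := bounded_subseq (fun k => (hs k).1).
  (* Numbers are read as vectors of length one, so that [bounded_subseq] also extracts from them. *)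
  pose t k : 'cV[R]_1 := const_mx (s (f k)).2.
  have te a b : enorm (const_mx a - const_mx b : 'cV[R]_1) = `|a - b|.
    by rewrite /enorm /dot big_ord1 !mxE -expr2 sqrtr_sqr.
  have [|f' [m [ff' fm]]] := @bounded_subseq R 1 t c.
    move=> k; have := te (s (f k)).2 0; rewrite (_ : const_mx 0 = 0); last first.
      by apply/matrixP => i j; rewrite !mxE.
    rewrite !subr0 => ->; have [_ /andP[? ?]] := hs (f k).
    by rewrite ger0_norm.
  have tm : (fun k => (s (f (f' k))).2) @ \oo --> m 0 0.
    apply/rcvgP => e /fm[N hN]; exists N => k /hN; rewrite /t /=.
    rewrite (_ : m = const_mx (m 0 0)) ?te ?mxE //.
    by apply/matrixP => i j; rewrite !mxE !ord1.
  have fl' := vcvg_sub ff' fl.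
  have cv := hc _ _ _ _ fl' tm.
  exists (l, m 0 0).
    split=> /=.
      apply: (cvgr_to_le (vcvg_enorm fl')).
      by apply: nearW => k; exact: (hs _).1.
    apply/andP; split.
      by apply: (cvgr_to_ge tm); apply: nearW => k; have [_ /andP[]] := hs (f (f' k)).
    by apply: (cvgr_to_le tm); apply: nearW => k; have [_ /andP[]] := hs (f (f' k)).
  move=> a /=; rewrite lte_fin => al N.
  have /rcvgP/(_ (h l (m 0 0) - a)) := cv; rewrite subr_gt0 => /(_ al)[N' hN'].
  exists (f (f' (maxn N N'))).
    exact: leq_trans (leq_trans (leq_maxl _ _) (ff' _)) (ff _).
  have := hN' _ (leq_maxr N N'); rewrite lte_fin distrC.
  set X := h (s _).1 _; have := ler_norm (h l (m 0 0) - X); rewrite /X /=; lra.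
- exists x, t; split=> // y a yr ac; have := hx (y, a) (conj yr ac).
  by rewrite lee_fin.
Qed.

End Minima.

(** Used after dividing a minimality inequality by the step [k]: the second-order remainder [k * c]
    disappears as [k] tends to 0. *)
Lemma ler_of_small (R : realFieldType) (a b c k0 : R) : 0 < k0 ->
  (forall k, 0 < k <= k0 -> a <= b + k * c) -> a <= b.
Proof.
move=> k00 h; rewrite leNgt; apply/negP => ba.
have [c0|c0] := leP c 0.
  have := h k0; rewrite k00 lexx => /(_ isT).
  have : k0 * c <= 0 by rewrite pmulr_rle0.
  by lra.
pose k := Num.min k0 ((a - b) / (2 * c)).
have kp : 0 < k by rewrite lt_min k00 divr_gt0 ?subr_gt0 // mulr_gt0.
have := h k; rewrite kp ge_min lexx => /(_ isT).
have : k * c <= (a - b) / 2.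
  rewrite -ler_pdivlMr // (le_trans (y := (a - b) / (2 * c))) ?ge_min ?lexx ?orbT //.
  by rewrite invfM mulrA.
by lra.
Qed.

(** Bridge from two-sided quadratic bounds to the derivative that the mean value theorem
    requires. *)
Lemma is_derive_quad (R : realType) (f : R -> R) (a l C : R) :
  (forall h, `|f (a + h) - f a - h * l| <= C * h ^+ 2) -> is_derive a 1 f l.
Proof.
move=> fC; suff cv : (fun h => h^-1 *: ((f \o shift a) (h *: 1) - f a)) @ 0^' --> l.
  apply: DeriveDef; first by apply/cvg_ex; exists l.
  exact: cvg_lim cv.
apply/cvgrPdist_le => e e0.
have C0 : 0 <= C.
  by have := fC 1; rewrite expr1n mulr1; apply: le_trans.
near=> h.
have h0 : h != 0 by near: h; exact: nbhs_dnbhs_neq.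
have hN : 0 < `|h| by rewrite normr_gt0.
rewrite -(ler_pM2l hN) -normrM mulrBr [h * (h^-1 *: _)]mulrA divff // mul1r /=.
rewrite [h *: 1]mulr1 (addrC h a) distrC.
apply: le_trans (fC h) _.
rewrite -real_normK ?num_real // expr2 mulrCA ler_pM2l //.
rewrite (le_trans (y := (C + 1) * `|h|)) //.
  by rewrite ler_wpM2r // lerDl.
rewrite mulrC -ler_pdivlMr ?ltr_wpDl //.
near: h; apply: dnbhs0_le; rewrite divr_gt0 // ltr_wpDl //.
Unshelve. all: by end_near. Qed.

(** * Coderivatives of a single-valued map *)

Section Coderivative.
Variables (R : realType) (n : nat).
Notation vec := 'cV[R]_n.
Variable F : vec -> vec.

(** States that [(w, - y)] is a regular normal to the graph of [F] at [(x, F x)]. The remainder is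
    measured by [|x' - x|] instead of the distance in the graph, which is equivalent for Lipschitz
    [F]; for the same reason [lcoderiv] does not mention convergence of [F (xs k)]. *)
Definition rcoderiv (x w y : vec) : Prop := forall e : R, 0 < e ->
  exists2 d : R, 0 < d & forall x', enorm (x' - x) < d ->
    dot w (x' - x) - dot y (F x' - F x) <= e * enorm (x' - x).

Definition lcoderiv (x w y : vec) : Prop :=
  exists xs ws ys : nat -> vec, [/\ vcvg xs x, vcvg ws w, vcvg ys y &
    forall k, rcoderiv (xs k) (ws k) (ys k)].

Lemma rcoderiv_quad x w y (d C : R) : 0 < d ->
  (forall k, enorm k < d -> dot w k - dot y (F (x + k) - F x) <= C * dot k k) ->
  rcoderiv x w y.
Proof.
move=> d0 h e e0.
have C0 : 0 < `|C| + 1 by rewrite ltr_wpDl.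
exists (Num.min d (e / (`|C| + 1))); first by rewrite lt_min d0 divr_gt0.
move=> x'; rewrite lt_min ltr_pdivlMr // => /andP[xd xe].
have := h _ xd; rewrite [x + _]addrC subrK => /le_trans; apply.
rewrite -enorm_sqr expr2 mulrA ler_wpM2r ?enorm_ge0 //.
apply: le_trans (ltW xe); rewrite mulrC ler_wpM2l ?enorm_ge0 //.
by rewrite (le_trans (ler_norm C)) // lerDl.
Qed.

Lemma rcoderivZ (a : R) x w y : 0 < a -> rcoderiv x w y -> rcoderiv x (a *: w) (a *: y).
Proof.
move=> a0 h e e0; have [|d d0 hd] := h (e / a); first by rewrite divr_gt0.
exists d => // x' /hd; rewrite !dotZl -mulrBr.
by rewrite -(ler_pM2l a0) mulrA (mulrC e) mulVKf ?gt_eqF.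
Qed.

End Coderivative.

(** * Gradients of strongly convex functions: bounds, solvability and symmetry of coderivatives *)

Section StronglyConvex.
Variables (R : realType) (n : nat).
Notation vec := 'cV[R]_n.
Variables (F : vec -> vec) (psi : vec -> R) (lam L : R).
Hypothesis lam_gt0 : 0 < lam.
Hypothesis lam_le : lam <= L.
Hypothesis F_lip : forall x y, enorm (F x - F y) <= L * enorm (x - y).
Hypothesis psi_ge : forall x y,
  psi x + dot (F x) (y - x) + lam / 2 * dot (y - x) (y - x) <= psi y.
Hypothesis psi_le : forall x y,
  psi y <= psi x + dot (F x) (y - x) + L / 2 * dot (y - x) (y - x).

Let L_gt0 : 0 < L. Proof. exact: lt_le_trans lam_le. Qed.

Lemma grad_strong_mono x y : lam * dot (x - y) (x - y) <= dot (F x - F y) (x - y).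
Proof.
have := psi_ge x y; have := psi_ge y x; by rewrite !dotE (dotC y x); lra.
Qed.

Lemma grad_dist_ge x y : lam * enorm (x - y) <= enorm (F x - F y).
Proof.
have [->|xy] := eqVneq x y; first by rewrite !subrr !enorm0 mulr0.
have h : 0 < enorm (x - y) by rewrite enorm_gt0 // subr_eq0.
rewrite -(ler_pM2r h) -mulrA -expr2 enorm_sqr.
exact: le_trans (grad_strong_mono x y) (dot_le _ _).
Qed.

(** A single [t] is enough: the bounds it is compared with scale linearly in [t], which then
    cancels. *)
Lemma rcoderiv_dir x w y v (e : R) : 0 < e -> rcoderiv F x w y ->
  exists2 t : R, 0 < t &
    t * dot w v - dot y (F (x + t *: v) - F x) <= t * e.
Proof.
move=> e0 h; have v1 : 0 < enorm v + 1 by rewrite ltr_wpDl ?enorm_ge0.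
have [|d d0 hd] := h (e / (enorm v + 1)); first by rewrite divr_gt0.
have t0 : 0 < d / (enorm v + 1) / 2 by rewrite !divr_gt0.
have tv : d / (enorm v + 1) / 2 * enorm v < d.
  rewrite mulrAC ltr_pdivrMr // mulrAC ltr_pdivrMr // -mulrA ltr_pM2l //.
  by have := enorm_ge0 v; lra.
exists (d / (enorm v + 1) / 2) => //; move: (_ / 2) t0 tv => t t0 tv.
have := hd (x + t *: v); rewrite addrAC subrr add0r enormZ (gtr0_norm t0).
move=> /(_ tv); rewrite dotZr => /le_trans; apply.
rewrite mulrCA ler_pM2l // mulrAC ler_pdivrMr // ler_pM2l //.
by rewrite lerDl.
Qed.

(** Tested in the direction [- y], where strong monotonicity bounds [- <y, F (x - t y) - F x>] below
    by [t lam |y|^2]. *)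
Lemma rcoderiv_ge x w y : rcoderiv F x w y -> lam * dot y y <= dot w y.
Proof.
move=> h; apply/ler_addgt0Pr => e e0.
have [t t0] := rcoderiv_dir (- y) e0 h.
have := grad_strong_mono (x + t *: - y) x; rewrite addrAC subrr add0r.
rewrite (dotC y (_ - _)); move: (F _ - F _) => f.
rewrite !dotE (_ : lam * _ = t * (t * (lam * dot y y))); last by ring.
by rewrite ler_pM2l // => h1 h2; rewrite -(ler_pM2l t0); lra.
Qed.

(** Tested in the direction [w], where the increment of [F] is at most [L t |w|]. *)
Lemma rcoderiv_le x w y : rcoderiv F x w y -> enorm w <= L * enorm y.
Proof.
move=> h; have [->|w0] := eqVneq w 0.
  by rewrite enorm0 mulr_ge0 ?enorm_ge0 ?ltW.
have wp := enorm_gt0 w0.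
apply/ler_addgt0Pr => e e0.
have [t t0 ht] := rcoderiv_dir w (mulr_gt0 e0 wp) h.
rewrite -(ler_pM2r wp) -(ler_pM2l t0) -expr2 enorm_sqr.
have := dot_le y (F (x + t *: w) - F x).
have := F_lip (x + t *: w) x; rewrite addrAC subrr add0r enormZ (gtr0_norm t0).
move=> /(ler_wpM2l (enorm_ge0 y)) h1 h2.
by have := le_trans h2 h1; rewrite !mulrDl !mulrDr; lra.
Qed.

Lemma vcvg_grad s l : vcvg s l -> vcvg (F \o s) (F l).
Proof. exact: vcvg_lip F_lip. Qed.

Lemma lcoderiv_ge x w y : lcoderiv F x w y -> lam * dot y y <= dot w y.
Proof.
move=> [xs [ws [ys [_ hw hy h]]]].
apply: (ler_cvg_to _ (dot_cvg hw hy)).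
  apply: cvgM; [exact: cvg_cst|exact: (dot_cvg hy hy)].
by apply: nearW => k; exact: rcoderiv_ge (h k).
Qed.

Lemma lcoderiv_le x w y : lcoderiv F x w y -> enorm w <= L * enorm y.
Proof.
move=> [xs [ws [ys [_ hw hy h]]]].
apply: (ler_cvg_to (vcvg_enorm hw)).
  apply: cvgM; [exact: cvg_cst|exact: vcvg_enorm hy].
by apply: nearW => k; exact: rcoderiv_le (h k).
Qed.

(* A minimiser [x'] of [x |-> - <w, x - u> + K/2 |F x - F u|^2] gives a regular
   coderivative element, with [x'] close to [u] for large [K]. *)
Lemma rcoderiv_exists u w (K : R) : 0 < K ->
  exists2 x, enorm (x - u) <= 2 * enorm w / lam ^+ 2 / K &
    rcoderiv F x w (K *: (F x - F u)).
Proof.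
(* [H u = 0] and [|F x - F u| >= lam |x - u|] confine the minimiser to radius [r]; minimising over
   radius [r + 1] leaves room for perturbations shorter than 1. *)
move=> K0; pose r := 2 * enorm w / lam ^+ 2 / K.
have r0 : 0 <= r by rewrite !divr_ge0 ?mulr_ge0 ?enorm_ge0 ?exprn_ge0 ?ltW.
pose H x := - dot w (x - u) + K / 2 * dot (F x - F u) (F x - F u).
have [||x xr hx] := @continuous_min_ball R n H u (r + 1); first by rewrite addr_ge0.
  move=> s l sl; apply: cvgD.
    apply: cvgN; apply: dot_cvg; first exact: vcvg_cst.
    by apply: vcvgD => //; exact: vcvg_cst.
  apply: cvgM; first exact: cvg_cst.
  have h : vcvg (fun k => F (s k) - F u) (F l - F u).
    by apply: vcvgD; [exact: vcvg_grad|exact: vcvg_cst].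
  exact: dot_cvg.
have xu : enorm (x - u) <= r.
  have [->|xu] := eqVneq x u; first by rewrite subrr enorm0.
  have h : 0 < enorm (x - u) by rewrite enorm_gt0 // subr_eq0.
  have := hx u; rewrite subrr enorm0 => /(_ (addr_ge0 r0 ler01)).
  rewrite /H !subrr !dot0r oppr0 mulr0 addr0 -enorm_sqr => h1.
  have h2 := dot_le w (x - u).
  have h3 : lam ^+ 2 * enorm (x - u) ^+ 2 <= enorm (F x - F u) ^+ 2.
    rewrite -exprMn ler_pXn2r ?nnegrE ?enorm_ge0 ?grad_dist_ge //.
    by rewrite mulr_ge0 ?enorm_ge0 // ltW.
  have h4 : K / 2 * (lam ^+ 2 * enorm (x - u) ^+ 2) <= enorm w * enorm (x - u).
    apply: le_trans (ler_wpM2l _ h3) _; first by rewrite divr_ge0 // ltW.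
    by lra.
  rewrite /r -mulrA -invfM ler_pdivlMr ?mulr_gt0 ?exprn_gt0 //.
  rewrite -(ler_pM2r h); lra.
exists x => //; apply: (@rcoderiv_quad _ _ _ _ _ _ 1 (K / 2 * L ^+ 2)) => // k k1.
have xk : enorm (x + k - u) <= r + 1.
  by rewrite addrAC (le_trans (enormD _ _)) // lerD // ltW.
have := hx _ xk; rewrite /H addrAC.
have h5 : dot (F (x + k) - F x) (F (x + k) - F x) <= L ^+ 2 * dot k k.
  rewrite -!enorm_sqr -exprMn ler_pXn2r ?nnegrE ?mulr_ge0 ?enorm_ge0 ?(ltW L_gt0) //.
  by have := F_lip (x + k) x; rewrite addrAC subrr add0r.
have K2 : 0 <= K / 2 by rewrite divr_ge0 // ltW.
have := ler_wpM2l K2 h5.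
rewrite (_ : F (x + k) - F u = (F x - F u) + (F (x + k) - F x)); last first.
  by rewrite [RHS]addrC subrKA.
move: (F x - F u) (F (x + k) - F x) => f g.
rewrite !dotE (dotC g f); lra.
Qed.

(** Solvability of the Newton inclusion. With [K = k + 1] the base points tend to [u], while
    [lam |y|^2 <= <w, y>] bounds the arguments [ys]. *)
Lemma lcoderiv_exists u w : exists y, lcoderiv F u w y.
Proof.
have h (k : nat) : exists x, enorm (x - u) <= 2 * enorm w / lam ^+ 2 / k.+1%:R /\
    exists y, rcoderiv F x w y.
  have [//|x h1 h2] := @rcoderiv_exists u w k.+1%:R.
  by exists x; split=> //; exists (k.+1%:R *: (F x - F u)).
have [xs hx] := choice h; have [ys hy] := choice (fun k => (hx k).2).
have [|f [l [ff fl]]] := @bounded_subseq R n ys (enorm w / lam).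
  move=> k; rewrite ler_pdivlMr //; have hk := rcoderiv_ge (hy k).
  have [->|y0] := eqVneq (ys k) 0; first by rewrite enorm0 mul0r enorm_ge0.
  rewrite -(ler_pM2r (enorm_gt0 y0)) mulrAC -expr2 enorm_sqr mulrC.
  exact: le_trans hk (dot_le _ _).
exists l, (xs \o f), (fun=> w), (ys \o f); split=> //.
- apply: vcvg_sub => //; apply: (vcvg_le (fun k => (hx k).1)).
  rewrite -(mulr0 (2 * enorm w / lam ^+ 2)).
  by apply: cvgM; [exact: cvg_cst|exact: cvg_harmonic].
- exact: vcvg_cst.
- by move=> k; exact: hy.
Qed.

Lemma psi_line_diff_derive b e k (r : R) :
  is_derive r 1 (fun r => psi (b + r *: e + k) - psi (b + r *: e))
    (dot (F (b + r *: e + k) - F (b + r *: e)) e).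
Proof.
apply: (@is_derive_quad _ _ _ _ (L / 2 * dot e e)) => h.
have e1 : b + (r + h) *: e - (b + r *: e) = h *: e.
  by rewrite scalerDl addrA [X in X - _]addrC addrK.
have e2 : b + (r + h) *: e + k - (b + r *: e + k) = h *: e.
  by rewrite opprD addrACA subrr addr0 e1.
have l0 : 0 <= lam / 2 * dot (h *: e) (h *: e).
  by rewrite mulr_ge0 ?dot_ge0 // divr_ge0 // ltW.
have := psi_le (b + r *: e) (b + (r + h) *: e).
have := psi_ge (b + r *: e) (b + (r + h) *: e).
have := psi_le (b + r *: e + k) (b + (r + h) *: e + k).
have := psi_ge (b + r *: e + k) (b + (r + h) *: e + k).
rewrite e1 e2; move: l0; rewrite ler_norml.
move: (F (b + r *: e)) (F (b + r *: e + k)) => f f'.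
by rewrite !dotE => *; apply/andP; split; lra.
Qed.

(* The Hessian of a smooth function is symmetric.  Nonsmooth substitute: a mean
   value argument for the second difference of [psi] along [e] and [d], followed
   by an approximate mean value inequality for [<e, F>] on a segment parallel to
   [d], in which the distance to the segment is penalised. *)
Lemma rcoderiv_sym x w d e (eta : R) : 0 < eta -> rcoderiv F x w d ->
  exists x' z, [/\ enorm (x' - x) < eta, rcoderiv F x' z e & dot w e - eta <= dot z d].
Proof.
move=> eta0 h.
have e1 : 0 < enorm e + 1 by rewrite ltr_wpDl ?enorm_ge0.
have d1 : 0 < enorm d + 1 by rewrite ltr_wpDl ?enorm_ge0.
have [dl dl0 hdl] := h (eta / 4 / (enorm e + 1)) (divr_gt0 (divr_gt0 eta0 (ltr0n _ 4)) e1).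
(* [x + t e] stays within [eta / 4] of [x] and within the radius [dl] where the inequality of [h] is
   available. *)
pose t := Num.min (eta / 4) (dl / 2) / (enorm e + 1).
have t0 : 0 < t by rewrite divr_gt0 // lt_min !divr_gt0.
have te : t * enorm e < Num.min (eta / 4) dl.
  apply: (@lt_le_trans _ _ (t * (enorm e + 1))); first by rewrite ltr_pM2l // ltrDl.
  rewrite /t divfK ?gt_eqF // le_min !ge_min lexx /= [dl / 2 <= dl](_ : _ = true) ?orbT //.
  by lra.
move: te; rewrite lt_min => /andP[te1 te2].
have Fd : t * (dot w e - eta / 4) <= dot d (F (x + t *: e) - F x).
  have := hdl (x + t *: e); rewrite addrAC subrr add0r enormZ (gtr0_norm t0).
  move=> /(_ te2); rewrite dotZr.
  have : eta / 4 / (enorm e + 1) * (t * enorm e) <= t * (eta / 4).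
    rewrite mulrCA ler_pM2l // mulrAC ler_pdivrMr // ler_pM2l ?divr_gt0 //.
    by rewrite lerDl.
  by rewrite mulrBr; lra.
(* [s] is small relative to [t]: the curvature error [L / 2 s^2 |d|^2] of the increment of [psi]
   along [d] is at most [s t eta / 4]. *)
pose s := Num.min (eta / 4) (t * eta / 2 / (L * (enorm d + 1))) / (enorm d + 1).
have s0 : 0 < s.
  apply: divr_gt0 => //; rewrite lt_min; apply/andP; split; first exact: divr_gt0.
  apply: divr_gt0; last exact: mulr_gt0.
  by apply: divr_gt0 => //; exact: mulr_gt0.
have sd1 : s * (enorm d + 1) <= eta / 4 by rewrite /s divfK ?gt_eqF // ge_min lexx.
have sd : s * enorm d <= eta / 4.
  by apply: le_trans sd1; rewrite ler_pM2l // lerDl.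
have sdd : L * s * dot d d <= t * eta / 2.
  have : s * (enorm d + 1) <= t * eta / 2 / (L * (enorm d + 1)).
    by rewrite /s divfK ?gt_eqF // ge_min lexx orbT.
  rewrite ler_pdivlMr ?mulr_gt0 //; apply: le_trans.
  rewrite -enorm_sqr (_ : s * _ * _ = L * s * (enorm d + 1) ^+ 2); last by ring.
  rewrite (ler_pM2l (mulr_gt0 L_gt0 s0)) ler_pXn2r ?nnegrE ?enorm_ge0 ?(ltW d1) //.
  by rewrite lerDl.
move: (s) s0 sd sdd => {sd1} {}s s0 sd sdd.
move: (t) t0 te1 Fd sdd => {te2} {}t t0 te1 Fd sdd.
pose D r := psi (x + r *: e + s *: d) - psi (x + r *: e).
have DD : s * t * (dot w e - eta / 2) <= D t - D 0.
  rewrite /D !scale0r !addr0.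
  have := psi_ge (x + t *: e) (x + t *: e + s *: d).
  have := psi_le x (x + s *: d).
  rewrite ![_ + s *: d - _]addrAC !subrr !add0r.
  have := mulr_ge0 (ltW lam_gt0) (dot_ge0 (s *: d)).
  have := ler_wpM2l (ltW s0) Fd; have := ler_wpM2l (ltW s0) sdd.
  by rewrite !dotE !(dotC d); lra.
have D_derive := psi_line_diff_derive x e (s *: d).
(* Exchange of the order of differencing: the mean value theorem in the direction [e] turns the
   second difference of [psi] into the increment of [<e, F>] from [a] to [a + s d]. *)
have [c /itvP c0t cE] := @MVT R D _ 0 t t0
   (fun r _ => D_derive r)
   (derivable_within_continuous (fun r _ => @ex_derive _ _ _ _ _ _ _ (D_derive r))).
pose a := x + c *: e.
have ax : enorm (a - x) < eta / 4.
  rewrite /a addrAC subrr add0r enormZ ger0_norm ?c0t //.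
  by apply: le_lt_trans te1; rewrite ler_wpM2r ?enorm_ge0 // c0t.
have Fa : s * (dot w e - eta / 2) <= dot e (F (a + s *: d)) - dot e (F a).
  rewrite -(ler_pM2r t0) mulrAC (le_trans DD) // cE subr0 ler_pM2r //.
  by rewrite -/a dotDl dotNl !(dotC e).
pose r0 := eta / 4; have r00 : 0 < r0 by rewrite divr_gt0.
pose E := L * (enorm e + 1); have E0 : 0 < E by rewrite mulr_gt0.
have FE u v : dot e (F u) - dot e (F v) <= E * enorm (u - v).
  rewrite -dotNr -dotDr; apply: le_trans (dot_le _ _) _.
  rewrite /E [leRHS]mulrAC [leLHS]mulrC; apply: ler_pM; rewrite ?enorm_ge0 //.
  by rewrite lerDl.
(* [E] is a Lipschitz constant of [<e, F>]. The term [E / r0] keeps the displacement [dt] inside its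
   ball, and [E ^+ 2 / (s * eta)] keeps [ta] away from the end [s]. *)
pose K := E / r0 + E + E ^+ 2 / (s * eta).
have k1 : 0 < E ^+ 2 / (s * eta).
  by apply: divr_gt0; [exact: exprn_gt0|exact: mulr_gt0].
have K0 : 0 < K by rewrite /K !addr_gt0 // divr_gt0.
have Kr : E < K * r0.
  have := mulr_gt0 k1 r00; have := mulr_gt0 E0 r00.
  by rewrite /K !mulrDl divfK ?gt_eqF //; lra.
have Ks : E ^+ 2 <= K * (s * eta).
  rewrite /K mulrDl (divfK (lt0r_neq0 (mulr_gt0 s0 eta0))) lerDr ltW //.
  apply: mulr_gt0; last exact: mulr_gt0.
  by rewrite addr_gt0 // divr_gt0.
move: (K) K0 Kr Ks => {k1} {}K K0 Kr Ks.
(* The tilt [rho] lies below the mean slope of [<e, F>] on the segment, by [Fa]; hence the minimum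
   of [H] is not at [ta = s] and [ta] can still be increased. *)
pose rho := dot w e - eta.
pose H dl ta := dot e (F (a + ta *: d + dl)) - ta * rho + K * dot dl dl.
have [|||dt [ta [dtr /andP[ta0 tas] hm]]] := @continuous_min_cylinder R n H r0 s.
- exact: ltW.
- exact: ltW.
- move=> sq tq l b sl tb; have al : vcvg (fun k => a + tq k *: d + sq k) (a + b *: d + l).
    by apply: vcvgD sl; apply: vcvgD; [|apply: vcvgZ => //]; exact: vcvg_cst.
  apply: cvgD; last by apply: cvgM; [exact: cvg_cst|exact: (dot_cvg sl sl)].
  apply: cvgB; last by apply: cvgM => //; exact: cvg_cst.
  by apply: dot_cvg (vcvg_grad al); exact: vcvg_cst.
have dtK : K * enorm dt <= E.
  have [->|dt0] := eqVneq dt 0; first by rewrite enorm0 mulr0 ltW.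
  rewrite -(ler_pM2r (enorm_gt0 dt0)) -mulrA -expr2 enorm_sqr.
  have := hm 0 ta; rewrite enorm0 ta0 tas => /(_ (ltW r00) isT).
  rewrite /H addr0 dot0r mulr0 addr0 => hh.
  have := FE (a + ta *: d) (a + ta *: d + dt).
  by rewrite opprD addNKr enormN; lra.
have dtr' : enorm dt < r0.
  by rewrite -(ltr_pM2l K0) (le_lt_trans dtK).
have tas' : ta < s.
  rewrite lt_neqAle tas andbT; apply/eqP => tE.
  have := hm 0 0; rewrite enorm0 lexx => /(_ (ltW r00) (ltW s0)).
  rewrite /H tE scale0r !addr0 mul0r dot0r mulr0 subr0 addr0.
  have := FE (a + s *: d) (a + s *: d + dt).
  rewrite opprD addNKr enormN -enorm_sqr => h1 h2.
  (* The maximum of [E q - K q^2] over [q] is [E^2 / (4 K)]. *)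
  have h3 : E * enorm dt - K * enorm dt ^+ 2 <= s * eta / 4.
    rewrite -(ler_pM2l K0).
    have := sqr_ge0 (E - 2 * (K * enorm dt)); move: Ks.
    move: (enorm dt) => q; rewrite !expr2; lra.
  by have := mulr_gt0 s0 eta0; move: Fa; rewrite /rho in h2; lra.
pose x' := a + ta *: d + dt.
exists x', (- (2 * K) *: dt); split.
- rewrite (_ : x' - x = ta *: d + dt + (a - x)); last by rewrite addrA [_ + a]addrC addrA.
  apply: le_lt_trans (enormD _ _) _.
  apply: (@le_lt_trans _ _ (s * enorm d + enorm dt + enorm (a - x))); last first.
    by rewrite /r0 in dtr'; lra.
  rewrite lerD // (le_trans (enormD _ _)) // lerD // enormZ ger0_norm //.
  by rewrite ler_wpM2r ?enorm_ge0.
- apply: (@rcoderiv_quad _ _ _ _ _ _ (r0 - enorm dt) K); first by rewrite subr_gt0.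
  move=> k kr; have := hm (dt + k) ta; rewrite ta0 tas.
  have -> : enorm (dt + k) <= r0.
    by apply: le_trans (enormD _ _) _; lra.
  move=> /(_ isT isT); rewrite /H addrA -/x' !dotE (dotC k dt); lra.
(* Adding [k] to [ta] and subtracting [k d] from [dt] leaves the point fixed, so only the tilt and
   the penalty change; as [k] tends to 0 this gives [rho <= <z, d>]. *)
- apply: (@ler_of_small _ _ _ (K * dot d d)
    (Num.min (s - ta) ((r0 - enorm dt) / (enorm d + 1)))).
    by rewrite lt_min subr_gt0 tas' divr_gt0 // subr_gt0.
  move=> k /andP[k0]; rewrite le_min ler_pdivlMr // => /andP[k1 k2].
  have := hm (dt - k *: d) (ta + k).
  have -> : 0 <= ta + k <= s by rewrite addr_ge0 ?(ltW k0) //=; lra.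
  have -> : enorm (dt - k *: d) <= r0.
    apply: le_trans (enormD _ _) _; rewrite enormN enormZ gtr0_norm //.
    by move: k2; rewrite mulrDr mulr1; lra.
  move=> /(_ isT isT); rewrite /H.
  rewrite (_ : a + (ta + k) *: d + (dt - k *: d) = a + ta *: d + dt); last first.
    by rewrite scalerDl addrA -[_ + dt - _]addrA [dt - _]addrC addrA addrA addrK.
  rewrite !dotE (dotC d dt) /rho => hh.
  rewrite -(ler_pM2l k0); lra.
Qed.

(** [rcoderiv_sym] along the defining sequences with [eta = 1 / (k + 1)]; the resulting elements are
    bounded by [L |e|], so a subsequence converges. *)
Lemma lcoderiv_sym x w d e : lcoderiv F x w d ->
  exists2 z, lcoderiv F x z e & dot w e <= dot z d.
Proof.
move=> [xs [ws [ds [hx hw hd h]]]].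
have hk (k : nat) : exists x', exists z,
    [/\ enorm (x' - xs k) < k.+1%:R^-1, rcoderiv F x' z e &
      dot (ws k) e - k.+1%:R^-1 <= dot z (ds k)].
  by apply: rcoderiv_sym => //; rewrite invr_gt0.
have [xs' hk'] := choice hk; have [zs hz] := choice hk'.
have [|f [z [ff fz]]] := @bounded_subseq R n zs (L * enorm e).
  by move=> k; have [_ hr _] := hz k; exact: rcoderiv_le hr.
have hx' : vcvg xs' x.
  have /vcvgP hx0 := hx.
  apply: (@vcvg_le _ _ _ _ (fun k => harmonic k + enorm (xs k - x))).
    move=> k; apply: le_trans (enorm_distD (xs k) _ _) _; rewrite lerD //.
    by have [/ltW] := hz k.
  by rewrite -(addr0 0); apply: cvgD => //; exact: cvg_harmonic.
exists z.
  exists (xs' \o f), (zs \o f), (fun=> e); split=> //.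
  - exact: vcvg_sub.
  - exact: vcvg_cst.
  - by move=> k; have [] := hz (f k).
have c1 : (fun k => dot (ws (f k)) e - harmonic (f k)) @ \oo --> dot w e.
  rewrite -[dot w e]subr0; apply: cvgB.
    by apply: dot_cvg; [exact: (vcvg_sub ff hw)|exact: vcvg_cst].
  have /rcvgP hh := @cvg_harmonic R.
  apply/rcvgP => q /hh[N hN]; exists N => k Nk; apply: hN.
  exact: leq_trans (ff k).
have c2 := dot_cvg fz (vcvg_sub ff hd).
by apply: (ler_cvg_to c1 c2); apply: nearW => k; have [_ _] := hz (f k).
Qed.

Variable ub : vec.
Hypothesis F_ub : F ub = 0.

Lemma psi_min_le u : psi u - psi ub <= L / 2 * dot (u - ub) (u - ub).
Proof. by have := psi_le ub u; rewrite F_ub dot0l; lra. Qed.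

Lemma psi_min_ge u : lam / 2 * dot (u - ub) (u - ub) <= psi u - psi ub.
Proof. by have := psi_ge ub u; rewrite F_ub dot0l; lra. Qed.

(** * Local theory under semismoothness*: superlinear directions and acceptance of the unit step *)

Section Semismooth.
(** Semismoothness* of [F] at its zero [ub] in uniform form. Scaling by [|y|] alone is legitimate
    because [|w| <= L |y|]. *)
Hypothesis F_semismooth : forall e : R, 0 < e -> exists2 d : R, 0 < d &
  forall x w y, enorm (x - ub) < d -> rcoderiv F x w y ->
    `|dot w (x - ub) - dot y (F x)| <= e * (enorm (x - ub) * enorm y).

Lemma lcoderiv_semismooth (e : R) : 0 < e -> exists2 d : R, 0 < d &
  forall x w y, enorm (x - ub) < d -> lcoderiv F x w y ->
    `|dot w (x - ub) - dot y (F x)| <= e * (enorm (x - ub) * enorm y).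
Proof.
move=> e0; have [d d0 hd] := F_semismooth e0; exists d => // x w y xd.
move=> [xs [ws [ys [hx hw hy h]]]].
have hxu : vcvg (fun k => xs k - ub) (x - ub).
  by apply: vcvgD => //; exact: vcvg_cst.
have c1 : (fun k => `|dot (ws k) (xs k - ub) - dot (ys k) (F (xs k))|) @ \oo -->
    `|dot w (x - ub) - dot y (F x)|.
  apply: cvg_norm; apply: cvgB; first exact: dot_cvg.
  exact: dot_cvg (vcvg_grad hx).
have c2 : (fun k => e * (enorm (xs k - ub) * enorm (ys k))) @ \oo -->
    e * (enorm (x - ub) * enorm y).
  apply: cvgM; first exact: cvg_cst.
  by apply: cvgM; exact: vcvg_enorm.
apply: (ler_cvg_to c1 c2).
have [|N hN] := hx (d - enorm (x - ub)); first by rewrite subr_gt0.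
exists N => // k /= Nk; apply: hd => //.
by have := hN k Nk; have := enorm_distD x (xs k) ub; lra.
Qed.

Lemma newton_dir_superlinear (e : R) : 0 < e -> exists2 d : R, 0 < d &
  forall u v, enorm (u - ub) < d -> lcoderiv F u (- F u) v ->
    enorm (u + v - ub) <= e * enorm (u - ub).
Proof.
move=> e0; have [d d0 hd] := lcoderiv_semismooth (mulr_gt0 e0 lam_gt0).
exists d => // u v ud h; pose w := ub - u - v.
have -> : enorm (u + v - ub) = enorm w by rewrite -enormN opprB opprD addrA.
have [->|w0] := eqVneq w 0; first by rewrite enorm0 mulr_ge0 ?enorm_ge0 ?ltW.
have [z hz zd] := lcoderiv_sym w h.
have := hd _ _ _ ud hz; rewrite ler_norml => /andP[h1 _].
have h2 := lcoderiv_ge hz.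
have wp := enorm_gt0 w0.
rewrite -(ler_pM2l lam_gt0) -(ler_pM2r wp) -mulrA -expr2 enorm_sqr.
have : dot z w = - dot z (u - ub) - dot z v by rewrite /w !dotE; ring.
move: zd; rewrite dotNl (dotC (F u)); lra.
Qed.

(* [psi x - psi ub - 1/2 <F x, x - ub>] has regular subgradients whose radial
   component is [o(|x - ub|^2)]; minimising it along a ray, with a penalty off the
   ray, shows that it is itself bounded below by [- o(|x - ub|^2)]. *)
Lemma psi_half_expansion (e : R) : 0 < e -> exists2 d : R, 0 < d &
  forall u, enorm (u - ub) < d ->
    dot (F u) (u - ub) / 2 - e * dot (u - ub) (u - ub) <= psi u - psi ub.
Proof.
move=> e0; have [d d0 hd] := F_semismooth e0.
exists (d / 2) => [|u ud]; first by rewrite divr_gt0.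
rewrite leNgt; apply/negP => Du.
have [w wE] : exists w, w = u - ub by exists (u - ub).
rewrite -wE in ud Du; have uE : u = ub + w by rewrite wE addrC subrK.
pose D x := psi x - psi ub - dot (F x) (x - ub) / 2.
have w0 : 0 < enorm w.
  apply: enorm_gt0; apply: contraTneq Du => w0.
  by rewrite uE w0 addr0 F_ub !dot0l mul0r mulr0 !subrr ltxx.
pose W := dot w w; have W0 : 0 < W by rewrite /W -enorm_sqr exprn_gt0.
have Dge x : - (L / 2 * dot (x - ub) (x - ub)) <= D x.
  rewrite /D; have := psi_min_ge x; have := dot_le (F x) (x - ub).
  have := F_lip x ub; rewrite F_ub subr0 => h1 h2.
  have h3 := ler_wpM2r (enorm_ge0 (x - ub)) h1; rewrite -mulrA -expr2 enorm_sqr in h3.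
  have : 0 <= lam / 2 * dot (x - ub) (x - ub).
    by rewrite mulr_ge0 ?dot_ge0 // divr_ge0 // ltW.
  by lra.
(* [K > 2 L] makes [H] nonnegative at [t = 0] and on [|k| = |w|], so its negative minimum avoids
   both; [K > e] gives the final contradiction. *)
pose K := 2 * L + 1 + e; have K0 : 0 < K by have := L_gt0; rewrite /K; lra.
pose H k t := D (ub + t *: w + k) + e * t ^+ 2 * W + K * dot k k.
have psi_cvg s l : vcvg s l -> psi \o s @ \oo --> psi l.
  move=> sl.
  have sl' : vcvg (fun k => s k - l) 0.
    by rewrite -(subrr l); apply: vcvgD => //; exact: vcvg_cst.
  have c1 : (fun k => psi l + dot (F l) (s k - l)) @ \oo --> psi l.
    rewrite -[X in _ --> X]addr0; apply: cvgD; first exact: cvg_cst.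
    by rewrite -(dot0r (F l)); apply: dot_cvg => //; exact: vcvg_cst.
  have c2 : (fun k => psi l + dot (F l) (s k - l) + L / 2 * dot (s k - l) (s k - l)) @ \oo
      --> psi l.
    rewrite -[X in _ --> X]addr0; apply: cvgD => //.
    rewrite [X in _ --> X](_ : 0 = L / 2 * dot (0 : vec) 0); last by rewrite dot0r mulr0.
    by apply: cvgM; [exact: cvg_cst|exact: (dot_cvg sl' sl')].
  apply: (squeeze_cvgr _ c1 c2); apply: nearW => k.
  rewrite psi_le andbT (le_trans _ (psi_ge l (s k))) // lerDl.
  by rewrite mulr_ge0 ?dot_ge0 // divr_ge0 // ltW.
have [|||k [t [kr /andP[t0 t1] hm]]] := @continuous_min_cylinder R n H (enorm w) 1.
- exact: ltW.
- by [].
- move=> sq tq l b sl tb.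
  have al : vcvg (fun k => ub + tq k *: w + sq k) (ub + b *: w + l).
    by apply: vcvgD sl; apply: vcvgD; [|apply: vcvgZ => //]; exact: vcvg_cst.
  have al' : vcvg (fun k => ub + tq k *: w + sq k - ub) (ub + b *: w + l - ub).
    by apply: vcvgD => //; exact: vcvg_cst.
  apply: cvgD; last by apply: cvgM; [exact: cvg_cst|exact: (dot_cvg sl sl)].
  apply: cvgD; last first.
    apply: cvgM; last exact: cvg_cst.
    by apply: cvgM; [exact: cvg_cst|apply: cvgM].
  apply: cvgB; last first.
    by apply: cvgM; [apply: (dot_cvg (vcvg_grad al) al')|exact: cvg_cst].
  by apply: cvgB; [exact: psi_cvg|exact: cvg_cst].
have Hneg : H k t < 0.
  have := hm 0 1; rewrite enorm0 ler01 lexx => /(_ (ltW w0) isT) /le_lt_trans; apply.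
  rewrite /H dot0r mulr0 !addr0 scale1r -uE expr1n mulr1.
  by rewrite /D /W -wE; lra.
have hE : ub + t *: w + k - ub = t *: w + k by rewrite addrAC [ub + _]addrC addrK.
have hh : dot (t *: w + k) (t *: w + k) <= 2 * (t ^+ 2 * W + dot k k).
  have := dot_ge0 (t *: w - k); rewrite /W !dotE (dotC w k) !expr2; lra.
have Dk := Dge (ub + t *: w + k); rewrite hE in Dk.
have t2 : 0 <= t ^+ 2 * W by rewrite mulr_ge0 ?sqr_ge0 ?ltW.
have t0' : 0 < t.
  rewrite lt_neqAle t0 andbT; apply/eqP => tE; move: Hneg Dk.
  rewrite /H -tE expr0n /= !mulr0 scale0r mul0r addr0 !add0r.
  have := mulr_ge0 (ltW L_gt0) (dot_ge0 k).
  have := mulr_ge0 (ltW e0) (dot_ge0 k); have := dot_ge0 k.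
  by rewrite /K; lra.
have kr' : enorm k < enorm w.
  rewrite lt_neqAle kr andbT; apply/eqP => kE; move: Hneg.
  have kW : dot k k = W by rewrite -enorm_sqr kE enorm_sqr.
  have tW : t ^+ 2 * W <= W.
    by rewrite -[leRHS]mul1r ler_pM2r // expr_le1.
  have := ler_wpM2l (ltW L_gt0) hh; have := ler_wpM2l (ltW L_gt0) tW.
  have := mulr_gt0 e0 W0; have := mulr_ge0 (ltW e0) t2; move: Dk.
  by rewrite /H kW /K; lra.
pose x := ub + t *: w + k.
(* Replacing [t] by [t - c] and [k] by [k + c w] keeps the point, so only the two added quadratic
   terms are compared. *)
have hK : 2 * e * t * W <= 2 * K * dot k w.
  apply: (@ler_of_small _ _ _ ((e + K) * W) (Num.min t ((enorm w - enorm k) / enorm w))).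
    by rewrite lt_min t0' divr_gt0 // subr_gt0.
  move=> c /andP[c0]; rewrite le_min ler_pdivlMr // => /andP[c1 c2].
  have := hm (k + c *: w) (t - c).
  have -> : 0 <= t - c <= 1 by apply/andP; split; lra.
  have -> : enorm (k + c *: w) <= enorm w.
    apply: le_trans (enormD _ _) _; rewrite enormZ gtr0_norm //; lra.
  move=> /(_ isT isT); rewrite /H.
  rewrite (_ : ub + (t - c) *: w + (k + c *: w) = ub + t *: w + k); last first.
    by apply/matrixP => i j; rewrite !mxE; ring.
  rewrite !dotE (dotC w k) -/W !expr2 => h1.
  rewrite -(ler_pM2l c0); lra.
(* Variation of [k] alone, doubled. In the semismoothness* estimate for this element the terms
   [<F x, x - ub>] cancel, and only [4 K <k, x - ub>] remains, to be confronted with [hK]. *)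
have hr : rcoderiv F x (- (4 * K) *: k - F x) (ub - x).
  apply: (@rcoderiv_quad _ _ _ _ _ _ (enorm w - enorm k) (2 * K + L)).
    by rewrite subr_gt0.
  move=> c ck; have := hm (k + c) t.
  rewrite t0 t1 (_ : enorm (k + c) <= enorm w); last first.
    by apply: le_trans (enormD _ _) _; lra.
  move=> /(_ isT isT); rewrite /H addrA -/x /D.
  have := psi_le x (x + c); have := grad_strong_mono (x + c) x.
  rewrite (addrAC x c (- x)) subrr add0r.
  have := mulr_ge0 (ltW lam_gt0) (dot_ge0 c).
  rewrite !dotE !(dotC (F _)) (dotC c k); lra.
have xub : x - ub = t *: w + k by rewrite /x hE.
have xd : enorm (x - ub) < d.
  rewrite xub (le_lt_trans (enormD _ _)) // enormZ ger0_norm //.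
  have : t * enorm w <= enorm w by rewrite ler_piMl // ltW.
  by lra.
have := hd _ _ _ xd hr.
rewrite (enorm_distC ub) -expr2 enorm_sqr -[ub - x]opprB dotNl (dotC _ (F x)).
rewrite dotDl dotNl opprK subrK dotZl xub ler_norml => /andP[h1 _].
have h2 := ler_wpM2l (ltW e0) hh.
have h3 := ler_wpM2l (ltW t0') hK.
have h4 : 0 < e * (t ^+ 2 * W) by rewrite !mulr_gt0.
have h5 : 0 <= e * dot k k by rewrite mulr_ge0 ?dot_ge0 // ltW.
have h6 : 0 <= L * dot k k by rewrite mulr_ge0 ?dot_ge0 // ltW.
have h7 := dot_ge0 k.
move: h1 h2 h3 h4; rewrite /K !dotE !expr2; lra.
Qed.

(** To leading order [<F u, v>] is [- <F u, u - ub>], while [psi u - psi ub] is at least half of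
    [<F u, u - ub>] and [psi (u + v) - psi ub] is negligible. The margin is thus about
    [(1 / 2 - sigma) lam |u - ub|^2], and [e] is chosen so that all errors stay below it. *)
Lemma newton_unit_step (sigma : R) : 0 < sigma < 1 / 2 -> exists2 d : R, 0 < d &
  forall u v, enorm (u - ub) < d -> lcoderiv F u (- F u) v ->
    psi (u + v) <= psi u + sigma * dot (F u) v.
Proof.
move=> /andP[s0 s1]; pose c := (1 / 2 - sigma) * lam.
have c0 : 0 < c by rewrite mulr_gt0 // subr_gt0.
pose e := Num.min 1 (c / (1 + 2 * L)).
have L2 : 0 < 1 + 2 * L by have := L_gt0; lra.
have e0 : 0 < e by rewrite lt_min ltr01 divr_gt0.
have e1 : e <= 1 by rewrite ge_min lexx.
have ec : e * (1 + 2 * L) <= c by rewrite -ler_pdivlMr // ge_min lexx orbT.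
have [d1 d10 hd1] := newton_dir_superlinear e0.
have [d2 d20 hd2] := psi_half_expansion e0.
exists (Num.min d1 d2) => [|u v]; first by rewrite lt_min d10.
rewrite lt_min => /andP[ud1 ud2] h.
have h1 := hd1 _ _ ud1 h; have h2 := hd2 _ ud2.
move: (e) e0 e1 ec h1 h2 => {hd1 hd2} {}e e0 e1 ec h1 h2.
have h3 := psi_min_le (u + v).
pose W := dot (u - ub) (u - ub); have W0 : 0 <= W by exact: dot_ge0.
have h4 : dot (u + v - ub) (u + v - ub) <= e * W.
  rewrite -enorm_sqr; apply: (@le_trans _ _ ((e * enorm (u - ub)) ^+ 2)).
    by rewrite ler_pXn2r ?nnegrE ?mulr_ge0 ?enorm_ge0 // ltW.
  by rewrite exprMn enorm_sqr -/W ler_wpM2r // expr2 ler_piMl // ltW.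
have h5 : - (e * L * W) <= dot (F u) (u + v - ub).
  apply: le_trans (dot_ge _ _); rewrite lerN2.
  have Fu : enorm (F u) <= L * enorm (u - ub) by have := F_lip u ub; rewrite F_ub subr0.
  apply: le_trans (ler_pM (enorm_ge0 _) (enorm_ge0 _) Fu h1) _.
  by rewrite /W -enorm_sqr (_ : L * _ * _ = e * L * enorm (u - ub) ^+ 2) //; ring.
have h6 : lam * W <= dot (F u) (u - ub).
  by have := grad_strong_mono u ub; rewrite F_ub subr0.
have h7 : dot (F u) v = dot (F u) (u + v - ub) - dot (F u) (u - ub) by rewrite !dotE; ring.
have h8 := ler_wpM2l (ltW L_gt0) h4.
have h9 := ler_wpM2l (ltW s0) h5.
have s2 : 0 <= 1 / 2 - sigma by rewrite subr_ge0 ltW.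
have h10 := ler_wpM2l s2 h6.
have h11 := ler_wpM2r W0 ec.
have h12 : sigma * (e * L * W) <= 1 / 2 * (e * L * W).
  by rewrite ler_wpM2r ?mulr_ge0 ?(ltW e0) ?(ltW L_gt0) // ltW.
have h13 : 0 <= e * W by rewrite mulr_ge0 // ltW.
have h14 : 0 <= L * (e * W) by rewrite mulr_ge0 // ltW.
rewrite h7; move: h2 h3; rewrite -/W /c in h11 *; lra.
Qed.

End Semismooth.

(** * The damped iteration: line search, linear rate, superlinear rate *)

Section DampedNewton.
Variables sigma beta : R.
Hypothesis sigma_itv : 0 < sigma < 1 / 2.
Hypothesis beta_itv : 0 < beta < 1.

Definition armijo_test (u d : vec) (j : nat) : Prop :=
  psi (u + beta ^+ j *: d) <= psi u + sigma * beta ^+ j * dot (F u) d.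

Definition damped_newton_step (u u' : vec) : Prop :=
  (F u = 0 /\ u' = u) \/
  exists d j, [/\ lcoderiv F u (- F u) d, armijo_test u d j,
    (forall i, (i < j)%N -> ~ armijo_test u d i) & u' = u + beta ^+ j *: d].

(** Since [lam |d|^2 <= - <F u, d>], the quadratic term [L / 2 t^2 |d|^2] consumes at most half of
    the linear decrease, and [sigma < 1 / 2]. *)
Lemma psi_short_step u d (t : R) : lcoderiv F u (- F u) d -> 0 < t -> L * t <= lam ->
  psi (u + t *: d) <= psi u + sigma * t * dot (F u) d.
Proof.
move=> h t0 tl; have /andP[s0 s1] := sigma_itv.
have := lcoderiv_ge h; rewrite dotNl => hd.
have := psi_le u (u + t *: d); rewrite (addrAC u) subrr add0r !dotE => h1.
have h2 := ler_wpM2r (dot_ge0 d) tl.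
have h3 : 0 <= lam * dot d d by rewrite mulr_ge0 ?dot_ge0 ?ltW.
have h4 : 0 <= (1 / 2 - sigma) * - dot (F u) d by apply: mulr_ge0; lra.
apply: le_trans h1 _.
have h5 : dot (F u) d + L / 2 * (t * dot d d) <= sigma * dot (F u) d by lra.
have := ler_wpM2l (ltW t0) h5; lra.
Qed.

Lemma armijo_exists u d : lcoderiv F u (- F u) d -> exists j, armijo_test u d j.
Proof.
move=> h; have /andP[b0 b1] := beta_itv.
have /cvgr0Pnorm_le/(_ (lam / L)) : (fun j => beta ^+ j) @ \oo --> (0 : R).
  by apply: cvg_expr; rewrite gtr0_norm.
have lL : 0 < lam / L by rewrite divr_gt0.
move=> /(_ lL)[N _ /(_ N (leqnn N))] /=.
rewrite normrX gtr0_norm // ler_pdivlMr // mulrC => hN.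
by exists N; apply: psi_short_step => //; exact: exprn_gt0.
Qed.

(** Unless [j = 0], the exponent [j - 1] has failed the test, so its step exceeds [lam / L] by
    [psi_short_step]. *)
Lemma armijo_step_ge u d j : lcoderiv F u (- F u) d ->
  (forall i, (i < j)%N -> ~ armijo_test u d i) -> beta * lam / L <= beta ^+ j.
Proof.
move=> h hj; have /andP[b0 b1] := beta_itv; rewrite ler_pdivrMr //.
case: j hj => [_|j hj].
  rewrite expr0 mul1r (le_trans _ lam_le) // ler_piMl // ltW //.
rewrite exprS -mulrA ler_pM2l // leNgt; apply/negP => hl.
apply: (hj j) => //; apply: psi_short_step => //; first exact: exprn_gt0.
by rewrite mulrC ltW.
Qed.

Lemma damped_newton_step_exists u : exists u', damped_newton_step u u'.
Proof.
have [Fu|Fu] := eqVneq (F u) 0; first by exists u; left.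
have [d hd] := lcoderiv_exists u (- F u).
have hj : exists j, `[< armijo_test u d j >].
  by have [j hj] := armijo_exists hd; exists j; apply/asboolP.
case: (ex_minnP hj) => j /asboolP hj1 hj2.
exists (u + beta ^+ j *: d); right; exists d, j; split=> // i ij /asboolP /hj2.
by rewrite leqNgt ij.
Qed.

(** Of the four factors [lam / L], one comes from the step size, two from [|d| >= lam / L |u - ub|]
    squared, and the last from [lam |d|^2 <= - <F u, d>] against
    [psi u - psi ub <= L / 2 |u - ub|^2], which also yields the [2]. *)
Let q := 1 - 2 * (sigma * beta * (lam / L) ^+ 4).

Let q_itv : 0 < q < 1.
Proof.
have /andP[b0 b1] := beta_itv; have /andP[s0 s1] := sigma_itv.
have k0 : 0 < lam / L by rewrite divr_gt0.
have k1 : (lam / L) ^+ 4 <= 1 by rewrite exprn_ile1 ?(ltW k0) // ler_pdivrMr // mul1r.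
have k4 : 0 < (lam / L) ^+ 4 by rewrite exprn_gt0.
have sb : 0 < sigma * beta by rewrite mulr_gt0.
have sb1 : sigma * beta < 1 / 2.
  by apply: lt_trans s1; rewrite gtr_pMr.
have : sigma * beta * (lam / L) ^+ 4 <= sigma * beta by rewrite ler_piMr // ltW.
have := mulr_gt0 sb k4; rewrite /q; lra.
Qed.

Lemma damped_newton_decrease u u' : damped_newton_step u u' ->
  psi u' - psi ub <= q * (psi u - psi ub).
Proof.
have /andP[b0 b1] := beta_itv; have /andP[s0 s1] := sigma_itv.
case=> [[Fu ->]|[d [j [hd hj hi ->]]]].
  suff -> : u = ub by rewrite subrr mulr0.
  apply/eqP; rewrite -subr_eq0; apply/eqP/enorm_eq0.
  apply/eqP; rewrite eq_le enorm_ge0 andbT -(ler_pM2l lam_gt0) mulr0.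
  by have := grad_dist_ge u ub; rewrite Fu F_ub subrr enorm0.
pose k := lam / L; have k0 : 0 < k by rewrite divr_gt0.
have lamE : lam = k * L by rewrite /k divfK ?gt_eqF.
have tj := armijo_step_ge hd hi; rewrite -mulrA -/k in tj.
have h1 := lcoderiv_ge hd; rewrite dotNl in h1.
pose W := dot (u - ub) (u - ub).
have h2 : k ^+ 2 * W <= dot d d.
  rewrite /W -!enorm_sqr -exprMn ler_pXn2r ?nnegrE ?(mulr_ge0 (ltW k0)) ?enorm_ge0 //.
  rewrite /k mulrAC ler_pdivrMr // [leRHS]mulrC.
  have := lcoderiv_le hd; rewrite enormN; apply: le_trans.
  by have := grad_dist_ge u ub; rewrite F_ub subr0.
have h3 := psi_min_le u; rewrite -/W in h3.
move: hj; rewrite /armijo_test => hj.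
have h4 : (beta * k) * (lam * (k ^+ 2 * W)) <= beta ^+ j * - dot (F u) d.
  apply: ler_pM => //.
  - by apply: mulr_ge0; exact: ltW.
  - apply: mulr_ge0; first exact: ltW.
    by apply: mulr_ge0; [exact: sqr_ge0|exact: dot_ge0].
  - exact: le_trans (ler_wpM2l (ltW lam_gt0) h2) h1.
have h5 := ler_wpM2l (ltW s0) h4.
have sbk : 0 <= 2 * (sigma * beta * k ^+ 4).
  by apply: mulr_ge0 => //; apply: mulr_ge0; [apply: mulr_ge0|apply: exprn_ge0]; exact: ltW.
have h6 := ler_wpM2l sbk h3.
have h7 : sigma * (beta * k * (lam * (k ^+ 2 * W))) =
    2 * (sigma * beta * k ^+ 4) * (L / 2 * W) by rewrite lamE; field.
by rewrite h7 in h5; rewrite /q -/k; lra.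
Qed.

Variable u : nat -> vec.
Hypothesis u_step : forall k, damped_newton_step (u k) (u k.+1).

Lemma damped_newton_linear : R_linear u ub.
Proof.
have /andP[q0 q1] := q_itv.
have h k : psi (u k) - psi ub <= q ^+ k * (psi (u 0%N) - psi ub).
  elim: k => [|k IH]; first by rewrite expr0 mul1r.
  apply: le_trans (damped_newton_decrease (u_step k)) _.
  by rewrite exprS -mulrA ler_pM2l.
have c0 : 0 <= psi (u 0%N) - psi ub.
  by apply: le_trans (psi_min_ge _); rewrite mulr_ge0 ?dot_ge0 // divr_ge0 // ltW.
pose c := 2 / lam * (psi (u 0%N) - psi ub).
have c1 : 0 <= c by rewrite mulr_ge0 // divr_ge0 // ltW.
(* Values contract by [q], hence distances by its square root, through [psi_min_ge]; the [+ 1] keeps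
   the constant positive if [u 0] is already [ub]. *)
exists (Num.sqrt c + 1), (Num.sqrt q); split; first by rewrite ltr_wpDl ?sqrtr_ge0.
split.
  by rewrite sqrtr_gt0 q0 /= -[ltRHS]sqrtr1 ltr_sqrt.
exists 0%N => k _; apply: (@le_trans _ _ (Num.sqrt c * Num.sqrt q ^+ k)); last first.
  by rewrite ler_wpM2r ?exprn_ge0 ?sqrtr_ge0 // lerDl.
apply: enorm_le; first by rewrite mulr_ge0 ?exprn_ge0 ?sqrtr_ge0.
rewrite exprMn exprAC !sqr_sqrtr ?(ltW q0) //.
have := le_trans (psi_min_ge (u k)) (h k).
rewrite -(ler_pM2l (divr_gt0 (ltr0n R 2) lam_gt0)).
rewrite mulrA mulf_div (mulrC 2) divff ?mulf_neq0 ?gt_eqF // mul1r.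
by move=> /le_trans; apply; rewrite /c (mulrC (q ^+ k)) mulrA.
Qed.

Lemma damped_newton_cvg : vcvg u ub.
Proof.
have [C [mu [C0 [/andP[m0 m1] [N hN]]]]] := damped_newton_linear.
move=> e e0; have /cvgr0Pnorm_lt/(_ _ e0)[N' _ hN'] :
    (fun k => C * mu ^+ k) @ \oo --> (0 : R).
  rewrite -(mulr0 C); apply: cvgM; first exact: cvg_cst.
  by apply: cvg_expr; rewrite gtr0_norm.
exists (maxn N N') => k; rewrite geq_max => /andP[Nk N'k].
apply: le_lt_trans (hN k Nk) _; apply: le_lt_trans (ler_norm _) _.
exact: hN'.
Qed.

Lemma damped_newton_superlinear :
  (forall e : R, 0 < e -> exists2 d : R, 0 < d &
    forall x w y, enorm (x - ub) < d -> rcoderiv F x w y ->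
      `|dot w (x - ub) - dot y (F x)| <= e * (enorm (x - ub) * enorm y)) ->
  Q_superlinear u ub.
Proof.
move=> ss e e0.
have e2 : 0 < e / 2 by rewrite divr_gt0.
have [d1 d10 h1] := newton_dir_superlinear ss e2.
have [d2 d20 h2] := newton_unit_step ss sigma_itv.
have d0 : 0 < Num.min d1 d2 by rewrite lt_min d10.
have [N hN] := damped_newton_cvg d0; exists N => k Nk.
have := hN k Nk; rewrite lt_min => /andP[k1 k2].
rewrite subr0 ger0_norm ?divr_ge0 ?enorm_ge0 //.
apply: (@le_lt_trans _ _ (e / 2)); last by lra.
(* At [u k = ub] the quotient is 0, by the convention that 0 has inverse 0. *)
have [uk|uk] := eqVneq (enorm (u k - ub)) 0; first by rewrite uk invr0 mulr0 ltW.
rewrite ler_pdivrMr; last by rewrite lt_def uk enorm_ge0.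
case: (u_step k) => [[Fu uE]|[d [j [hd hj hi uE]]]].
  have := grad_dist_ge (u k) ub; rewrite Fu F_ub subrr enorm0 uE => hh.
  have : enorm (u k - ub) <= 0 by rewrite -(ler_pM2l lam_gt0) mulr0.
  by move/le_trans; apply; rewrite mulr_ge0 ?enorm_ge0 // ltW.
have j0 : j = 0%N.
  case: j hi {hj uE} => // j /(_ 0%N isT) []; rewrite /armijo_test expr0 scale1r mulr1.
  exact: h2.
by rewrite uE j0 expr0 scale1r; exact: h1.
Qed.

End DampedNewton.

End StronglyConvex.

(** * Positive-definite matrices *)

Section PositiveDefinite.
Variables (R : realType) (n : nat).
Notation vec := 'cV[R]_n.
Implicit Types (M : 'M[R]_n) (x y : vec).

Lemma posdef_unitmx M : posdef M -> M \in unitmx.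
Proof.
move=> Mp; rewrite -unitmx_tr -row_free_unit -kermx_eq0.
apply/rowV0P => v /sub_kermxP vM; apply/eqP; apply: contraT => v0.
have : v^T != 0 by rewrite -trmx0 (inj_eq (@trmx_inj _ _ _)).
move/Mp; suff -> : M *m v^T = 0 by rewrite dot0l ltxx.
by apply: trmx_inj; rewrite trmx_mul trmxK vM trmx0.
Qed.

Lemma sym_dot M x y : sym_mx M -> dot (M *m x) y = dot x (M *m y).
Proof. by rewrite dot_mulmxl => ->. Qed.

Lemma posdef_ge0 M x : posdef M -> 0 <= dot (M *m x) x.
Proof.
move=> Mp; have [->|/Mp/ltW//] := eqVneq x 0; by rewrite mulmx0 dot0l.
Qed.

Lemma posdef_CauchySchwarz M x y : sym_mx M -> posdef M ->
  dot (M *m x) y ^+ 2 <= dot (M *m x) x * dot (M *m y) y.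
Proof.
move=> Ms Mp; have [->|y0] := eqVneq y 0.
  by rewrite mulmx0 !dot0r mulr0 expr0n.
have yp := Mp _ y0.
have := posdef_ge0 (dot (M *m y) y *: x - dot (M *m x) y *: y) Mp.
rewrite mulmxBr -!scalemxAr !dotE (sym_dot y x Ms) (dotC y (M *m x)).
rewrite (_ : _ + _ = dot (M *m y) y *
  (dot (M *m x) x * dot (M *m y) y - dot (M *m x) y ^+ 2)); last by ring.
by rewrite pmulr_rge0 // subr_ge0.
Qed.

(** Without eigenvalues: Cauchy-Schwarz for [M] at [M^-1 x] and [x] gives
    [|x|^4 <= <x, M^-1 x> <M x, x>], so the inverse of a bound on [M^-1] is a modulus. *)
Lemma posdef_strong M : sym_mx M -> posdef M ->
  exists2 lam : R, 0 < lam & forall x, lam * dot x x <= dot (M *m x) x.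
Proof.
move=> Ms Mp; have Mu := posdef_unitmx Mp.
have [C C0 hC] := mulmx_bound (invmx M).
exists C^-1 => [|x]; first by rewrite invr_gt0.
have [->|x0] := eqVneq x 0; first by rewrite mulmx0 !dot0l mulr0.
have xp : 0 < dot x x by rewrite -enorm_sqr exprn_gt0 ?enorm_gt0.
have := posdef_CauchySchwarz (invmx M *m x) x Ms Mp; rewrite mulKVmx // => h.
rewrite mulrC ler_pdivrMr // -(ler_pM2l xp) -expr2 (le_trans h) //.
rewrite [leRHS](_ : _ = C * dot x x * dot (M *m x) x); last by ring.
rewrite ler_wpM2r ?posdef_ge0 //; apply: le_trans (dot_le _ _) _.
by rewrite -enorm_sqr expr2 mulrCA ler_wpM2l ?enorm_ge0.
Qed.

End PositiveDefinite.

(** * Minimising the sum of a smooth strongly convex function and a convex one *)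

Section Composite.
Variables (R : realType) (n : nat).
Notation vec := 'cV[R]_n.
Variable g : vec -> \bar R.
Hypothesis g_proper : proper_fun g.
Hypothesis g_lsc : lsc_fun g.
Hypothesis g_convex : convex_fun g.

Let g_noo x : g x != -oo%E. Proof. exact: g_proper.2. Qed.

Lemma subdiff_mono x y v w : subdiff g x v -> subdiff g y w -> 0 <= dot (v - w) (x - y).
Proof.
move=> [/fineK gx hx] [/fineK gy hy].
have := hx y; have := hy x; rewrite -gx -gy -!EFinD !lee_fin.
by rewrite -(opprB x y) !dotE; lra.
Qed.

(** With [m] the minimum of [g] on the unit ball around [x0], convexity along rays from [x0]
    prevents a descent faster than [r - m] outside it. This lower bound stands in for an affine
    minorant. *)
Lemma convex_linear_minorant x0 (r : R) : g x0 = r%:E ->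
  exists2 c : R, 0 <= c & forall y, ((r - c * (1 + enorm (y - x0)))%:E <= g y)%E.
Proof.
move=> gx0.
have [z z1 hz] := lsc_min_ball x0 ler01 g_noo g_lsc.
have zr : (g z <= r%:E)%E by rewrite -gx0 hz // subrr enorm0.
have [m gz] : exists m, g z = m%:E.
  by move: zr (g_noo z); case: (g z) => // m _ _; exists m.
rewrite gz lee_fin in zr hz.
exists (r - m) => [|y]; first by rewrite subr_ge0.
have [y1|y1] := leP (enorm (y - x0)) 1.
  apply: le_trans (hz _ y1); rewrite lee_fin.
  have : 0 <= (r - m) * enorm (y - x0) by rewrite mulr_ge0 ?enorm_ge0 ?subr_ge0.
  by lra.
move: y1; set s := enorm (y - x0) => y1.
have s0 : 0 < s by lra.
have l01 : 0 < s^-1 < 1 by rewrite invr_gt0 s0 invf_lt1.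
have := g_convex y x0 l01.
have := hz (s^-1 *: y + (1 - s^-1) *: x0).
rewrite (_ : _ - x0 = s^-1 *: (y - x0)); last first.
  by apply/matrixP => i j; rewrite !mxE; ring.
rewrite enormZ gtr0_norm ?invr_gt0 // -/s mulVf ?gt_eqF // lexx => /(_ isT) h1 h2.
have := le_trans h1 h2; rewrite gx0.
move: (g_noo y); case: (g y) => [t| |] // _; last by rewrite leey.
rewrite -!EFinM -EFinD !lee_fin -(ler_pM2l s0) mulrDr !mulrA mulrBr mulr1.
rewrite mulfV ?gt_eqF // mul1r.
have : 0 <= r - m by rewrite subr_ge0.
by lra.
Qed.

Section Minimum.
Variables (f : vec -> R) (G : vec -> vec) (a C : R).
Hypothesis a_gt0 : 0 < a.
Hypothesis f_ge : forall x y, f x + dot (G x) (y - x) + a * dot (y - x) (y - x) <= f y.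
Hypothesis f_le : forall x y, f y <= f x + dot (G x) (y - x) + C * dot (y - x) (y - x).

Let h x := ((f x)%:E + g x)%E.

Let f_lsc x (e : R) : 0 < e ->
  exists2 d : R, 0 < d & forall y, enorm (y - x) < d -> f x - e < f y.
Proof.
move=> e0; have G1 : 0 < enorm (G x) + 1 by rewrite ltr_wpDl ?enorm_ge0.
exists (e / (enorm (G x) + 1)) => [|y]; first by rewrite divr_gt0.
rewrite ltr_pdivlMr // mulrDr mulr1 => hy; have := f_ge x y.
have := mulr_ge0 (ltW a_gt0) (dot_ge0 (y - x)).
have := dot_ge (G x) (y - x); have := enorm_ge0 (y - x); lra.
Qed.

Lemma composite_min_exists : exists x, forall y, (h x <= h y)%E.
Proof.
have [x0 gx0] := g_proper.1.
have [r gr] : exists r, g x0 = r%:E by exists (fine (g x0)); rewrite fineK.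
have [c c0 hc] := convex_linear_minorant gr.
have hnoo x : h x != -oo%E by rewrite /h adde_eq_ninfty negb_or /= g_noo.
have hlsc : lsc_fun h.
  move=> x t; rewrite /h addeC -lteBlDr // => /lte_real_between[b].
  rewrite -EFinB lte_fin => tb bg.
  have [d1 [d10 h1]] := g_lsc bg.
  have e0 : 0 < b - (t - f x) by rewrite subr_gt0.
  have [d2 d20 h2] := f_lsc x e0.
  exists (Num.min d1 d2); split; first by rewrite lt_min d10.
  move=> y; rewrite lt_min => /andP[/h1 y1 /h2 y2].
  rewrite addeC -lteBlDr // -EFinB; apply: le_lt_trans y1.
  by rewrite lee_fin; lra.
(* Beyond radius [rho] the quadratic growth dominates the slope [B]; [c] is doubled because
   [1 + s <= 2 * s] there. *)
pose B := enorm (G x0) + 2 * c; have B0 : 0 <= B.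
  by rewrite addr_ge0 ?enorm_ge0 ?mulr_ge0.
pose rho := B / a + 1; have rho1 : 1 <= rho by rewrite lerDr divr_ge0 // ltW.
have [x xr hx] := lsc_min_ball x0 (le_trans ler01 rho1) hnoo hlsc.
exists x => y; have [yr|yr] := leP (enorm (y - x0)) rho; first exact: hx.
apply: (@le_trans _ _ (h x0)).
  by apply: hx; rewrite subrr enorm0 (le_trans ler01).
apply: (@le_trans _ _ ((f y)%:E + (r - c * (1 + enorm (y - x0)))%:E)%E); last first.
  by rewrite leeD2l.
rewrite /h gr -!EFinD lee_fin; have := f_ge x0 y.
have := dot_ge (G x0) (y - x0); rewrite -enorm_sqr.
move: (enorm (y - x0)) yr => s yr.
have s1 : 1 < s by lra.
have s0 : 0 < s by lra.
have : B <= a * s.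
  by rewrite mulrC -ler_pdivrMr // (le_trans _ (ltW yr)) // lerDl.
move/(ler_wpM2r (ltW s0)); rewrite /B.
have : c <= c * s by rewrite ler_peMr // ltW.
by rewrite expr2; lra.
Qed.

Lemma composite_min_strong x v y : subdiff g x v ->
  ((f x + dot (G x + v) (y - x) + a * dot (y - x) (y - x))%:E + g x <= h y)%E.
Proof.
move=> [gx hx]; have := hx y; rewrite -(fineK gx).
rewrite /h; move: (g_noo y); case: (g y) => [t| |] // _; last by move=> _; rewrite addey ?leey.
rewrite -!EFinD !lee_fin; have := f_ge x y; rewrite dotDl; lra.
Qed.

(** Fermat's rule. For the forward direction, minimality is tested on the segment from [x] to [y];
    after division by [t] the error of [f_le] is [t C |y - x|^2]. *)
Lemma composite_minP x : (forall y, (h x <= h y)%E) <-> subdiff g x (- G x).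
Proof.
split=> [hx|sx y]; last first.
  apply: le_trans (composite_min_strong y sx); rewrite /h leeD2r // lee_fin.
  by rewrite addrN dot0l addr0 lerDl mulr_ge0 ?dot_ge0 // ltW.
have gx : g x \is a fin_num.
  have [x0 gx0] := g_proper.1; have := hx x0; rewrite /h -(fineK gx0) -EFinD.
  by move: (g_noo x); case: (g x).
split=> // y; rewrite -(fineK gx).
have [gy|gy] := boolP (g y \is a fin_num); last first.
  by move: gy (g_noo y); case: (g y) => //; rewrite leey.
rewrite -(fineK gy) -EFinD lee_fin dotNl lerBlDr.
apply: (@ler_of_small _ _ _ (C * dot (y - x) (y - x)) (1 / 2)) => // t /andP[t0 t1].
have t01 : 0 < t < 1 by rewrite t0 /=; lra.
have := hx (t *: y + (1 - t) *: x); have := g_convex y x t01.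
rewrite /h -(fineK gx) -(fineK gy) -!EFinM -EFinD => h1 h2.
have := le_trans h2 (leeD2l _ h1); rewrite -!EFinD lee_fin.
have := f_le x (t *: y + (1 - t) *: x).
rewrite (_ : t *: y + (1 - t) *: x - x = t *: (y - x)); last first.
  by apply/matrixP => i j; rewrite !mxE; ring.
rewrite dotZl !dotZr => h3 h4; rewrite -(ler_pM2l t0); lra.
Qed.

Lemma composite_min_unique x y :
  (forall z, (h x <= h z)%E) -> (forall z, (h y <= h z)%E) -> x = y.
Proof.
move=> /composite_minP sx hy; have := composite_min_strong y sx.
move=> /le_trans /(_ (hy x)); rewrite /h; have [gx _] := sx.
rewrite -(fineK gx) -!EFinD lee_fin addrN dot0l addr0 => hh.
have : dot (y - x) (y - x) <= 0 by rewrite -(pmulr_rle0 _ a_gt0); lra.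
move=> d0; apply/eqP; rewrite eq_sym -subr_eq0; apply/eqP/dot_eq0/eqP.
by rewrite eq_le d0 dot_ge0.
Qed.

End Minimum.
End Composite.

Section ProductSpace.
Variables (R : realType) (n : nat).
Notation vec := 'cV[R]_n.
Implicit Types (a : vec * vec).

Lemma pnorm_fst a : enorm a.1 <= pnorm a.
Proof. by apply: ler_wsqrtr; rewrite /pdot lerDl dot_ge0. Qed.

Lemma pnorm_snd a : enorm a.2 <= pnorm a.
Proof. by apply: ler_wsqrtr; rewrite /pdot lerDr dot_ge0. Qed.

Lemma pnorm_le a : pnorm a <= enorm a.1 + enorm a.2.
Proof.
have s0 : 0 <= enorm a.1 + enorm a.2 by rewrite addr_ge0 ?enorm_ge0.
rewrite -[leRHS](ger0_norm s0) -sqrtr_sqr; apply: ler_wsqrtr.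
rewrite sqrrD !enorm_sqr /pdot.
by have := mulr_ge0 (enorm_ge0 a.1) (enorm_ge0 a.2); lra.
Qed.

Lemma pcvgP (s : nat -> vec * vec) (l : vec * vec) :
  pcvg s l <-> vcvg (fun k => (s k).1) l.1 /\ vcvg (fun k => (s k).2) l.2.
Proof.
split=> [h|[h1 h2] e e0].
  split=> e /h[N hN]; exists N => k /hN; apply: le_lt_trans.
    exact: (pnorm_fst (psub (s k) l)).
  exact: (pnorm_snd (psub (s k) l)).
have e2 : 0 < e / 2 by rewrite divr_gt0.
have [N1 hN1] := h1 _ e2; have [N2 hN2] := h2 _ e2.
exists (maxn N1 N2) => k; rewrite geq_max => /andP[/hN1 k1 /hN2 k2].
by apply: le_lt_trans (pnorm_le _) _; rewrite /psub /=; lra.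
Qed.

End ProductSpace.

(** * The proximal map and the Moreau envelope *)

Section Prox.
Variables (R : realType) (n : nat).
Notation vec := 'cV[R]_n.
Variables (g : vec -> \bar R) (gam : R).
Hypothesis g_proper : proper_fun g.
Hypothesis g_lsc : lsc_fun g.
Hypothesis g_convex : convex_fun g.
Hypothesis gam_gt0 : 0 < gam.

Let qu (u y : vec) : R := 1 / (2 * gam) * enorm (y - u) ^+ 2.
Let dqu (u y : vec) : vec := gam^-1 *: (y - u).

Let quE u x y : qu u y = qu u x + dot (dqu u x) (y - x)
  + 1 / (2 * gam) * dot (y - x) (y - x).
Proof.
rewrite /qu /dqu !enorm_sqr -[y - u](subrKA x).
move: (y - x) (x - u) => a b; rewrite !dotE (dotC b a); field.
by rewrite gt_eqF.
Qed.

Let gam2 : 0 < 1 / (2 * gam). Proof. by rewrite divr_gt0 // mulr_gt0. Qed.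

Let quE_ge u x y : qu u x + dot (dqu u x) (y - x)
  + 1 / (2 * gam) * dot (y - x) (y - x) <= qu u y.
Proof. by rewrite -quE. Qed.

Let quE_le u x y : qu u y <= qu u x + dot (dqu u x) (y - x)
  + 1 / (2 * gam) * dot (y - x) (y - x).
Proof. by rewrite -quE. Qed.

Let prox_minP u v : prox g gam u v <->
  forall y, ((qu u v)%:E + g v <= (qu u y)%:E + g y)%E.
Proof. by split=> h y; have := h y; rewrite ![((qu u _)%:E + _)%E]addeC. Qed.

Lemma prox_subdiff u v : prox g gam u v <-> subdiff g v (gam^-1 *: (u - v)).
Proof.
rewrite prox_minP (composite_minP g_proper g_convex gam2 (quE_ge u) (quE_le u)).
by rewrite /dqu -scalerN opprB.
Qed.

Lemma prox_unique u v w : prox g gam u v -> prox g gam u w -> v = w.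
Proof.
move=> /prox_minP hv /prox_minP hw.
exact: (composite_min_unique g_proper g_convex gam2 (quE_ge u) (quE_le u) hv hw).
Qed.

Lemma prox_exists u : exists v, prox g gam u v.
Proof.
have [v hv] := composite_min_exists g_proper g_lsc g_convex gam2 (quE_ge u).
by exists v; apply/prox_minP.
Qed.

Variable p : vec -> vec.
Hypothesis proxp : forall u, prox g gam u (p u).

(** Minty's parametrisation: a point [(x, y)] of the graph is recovered from [x + gam y]. *)
Lemma gph_subdiff_prox x y : gph_subdiff g (x, y) <-> p (x + gam *: y) = x.
Proof.
have e : gam^-1 *: (x + gam *: y - x) = y.
  by rewrite addrAC subrr add0r scalerA mulVf ?gt_eqF // scale1r.
split=> [h|h].
  by apply: (@prox_unique (x + gam *: y)) => //; apply/prox_subdiff; rewrite e.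
by have := proxp (x + gam *: y); rewrite h => /prox_subdiff; rewrite e.
Qed.

Lemma gph_prox u : gph_subdiff g (p u, gam^-1 *: (u - p u)).
Proof. exact/prox_subdiff. Qed.

Lemma prox_firm u v : 0 <= dot (p u - p v) ((u - p u) - (v - p v)).
Proof.
have /prox_subdiff su := proxp u; have /prox_subdiff sv := proxp v.
have := subdiff_mono su sv; rewrite -scalerBr dotZl pmulr_rge0 ?invr_gt0 //.
by rewrite dotC.
Qed.

Lemma prox_nonexpansive u v : enorm (p u - p v) <= enorm (u - v).
Proof.
have := prox_firm u v; rewrite (_ : u - p u - (v - p v) = (u - v) - (p u - p v)); last first.
  by apply/matrixP => i j; rewrite !mxE; ring.
rewrite dotDr dotNr subr_ge0 => h.
have [->|d0] := eqVneq (p u - p v) 0; first by rewrite enorm0 enorm_ge0.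
rewrite -(ler_pM2l (enorm_gt0 d0)) -expr2 enorm_sqr.
exact: le_trans h (dot_le _ _).
Qed.

(** [gam] times the Moreau envelope, with gradient [u - p u]. *)
Definition moreau_real (u : vec) : R :=
  gam * fine (g (p u)) + 1 / 2 * dot (u - p u) (u - p u).

Let gp_fin u : g (p u) \is a fin_num.
Proof. by have /prox_subdiff[] := proxp u. Qed.

Lemma moreauE u : (gam%:E * moreau g gam u)%E = (moreau_real u)%:E.
Proof.
have -> : moreau g gam u = (g (p u) + (qu u (p u))%:E)%E.
  apply/le_anti/andP; split; first by apply: ereal_inf_lbound; exists (p u).
  by apply: le_ereal_inf_tmp => _ [y _ <-]; exact: proxp.
rewrite -(fineK (gp_fin u)) -EFinD -EFinM /moreau_real; congr (_%:E).
rewrite /qu enorm_distC enorm_sqr mulrDr; congr (_ + _).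
by field; rewrite gt_eqF.
Qed.

(** The subgradient inequality at [p u] is evaluated at [p v]; what is left over is half the square
    of [(v - p v) - (u - p u)]. *)
Lemma moreau_real_ge u v : moreau_real u + dot (u - p u) (v - u) <= moreau_real v.
Proof.
have /prox_subdiff[_ /(_ (p v))] := proxp u.
rewrite -(fineK (gp_fin u)) -(fineK (gp_fin v)) -EFinD lee_fin.
rewrite -(ler_pM2l gam_gt0) mulrDr dotZl mulVKf ?gt_eqF // /moreau_real.
have := dot_ge0 ((v - p v) - (u - p u)).
rewrite !dotE (dotC v u) (dotC (p v) u) (dotC (p u) u) (dotC (p v) v) (dotC (p u) v)
  (dotC (p v) (p u)); lra.
Qed.

(** [p u] is a competitor in the minimisation that defines [p v]. *)
Lemma moreau_real_le u v :
  moreau_real v <= moreau_real u + dot (u - p u) (v - u) + 1 / 2 * dot (v - u) (v - u).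
Proof.
have := proxp v (p u); rewrite -(fineK (gp_fin u)) -(fineK (gp_fin v)) -!EFinD lee_fin.
rewrite !enorm_sqr -(ler_pM2l gam_gt0) !mulrDr !(mulrA gam (1 / (2 * gam))).
rewrite (_ : gam * (1 / (2 * gam)) = 1 / 2); last by field; rewrite gt_eqF.
rewrite /moreau_real !dotE (dotC v u) (dotC (p v) v) (dotC (p u) v) (dotC (p u) u); lra.
Qed.

End Prox.

(** * The function [psi] and the passage from normals of the subgradient graph to coderivatives of
    its gradient *)

Section Problem.
Variables (R : realType) (n : nat).
Notation vec := 'cV[R]_n.
Variables (A : 'M[R]_n) (b : vec) (g : vec -> \bar R) (gam : R) (p : vec -> vec).
Hypothesis A_sym : sym_mx A.
Hypothesis A_pos : posdef A.
Hypothesis g_proper : proper_fun g.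
Hypothesis g_convex : convex_fun g.
Hypothesis gam_gt0 : 0 < gam.
Hypothesis M_pos : posdef (1%:M - gam *: A).
Hypothesis proxp : forall u, prox g gam u (p u).

Let M : 'M[R]_n := 1%:M - gam *: A.
Let Q := Qm A gam.
Let P := Pm A gam.
Let c := cv A b gam.

Let M_unit : M \in unitmx. Proof. exact: posdef_unitmx. Qed.

Let Q_sym : sym_mx Q.
Proof.
by rewrite /sym_mx /Q /Qm trmx_inv linearB /= trmx1 linearZ /= A_sym.
Qed.

Let PE (x : vec) : P *m x = Q *m x - x.
Proof. by rewrite /P /Pm mulmxBl mul1mx. Qed.

Let MQ (x : vec) : M *m (Q *m x) = x.
Proof. by rewrite mulKVmx. Qed.

Lemma Pm_sym : sym_mx P.
Proof. by rewrite /sym_mx /P /Pm linearB /= trmx1 -/Q Q_sym. Qed.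

(* Write [u = M x] with [M = 1 - gam A]; then [<P u, u> = gam (<A x, x> - gam |A x|^2)],
   which the Cauchy-Schwarz inequality for [A] and positivity of [M] at [A x] bound
   away from zero. *)
Lemma Pm_posdef : posdef P.
Proof.
move=> u u0; pose x := Q *m u.
have uE : u = x - gam *: (A *m x).
  by rewrite -{1}(MQ u) -/x /M mulmxBl mul1mx scalemxAl.
have x0 : x != 0 by apply: contra_neq u0 => x0; rewrite uE x0 mulmx0 scaler0 subr0.
rewrite PE -/x {1}uE opprB addrC subrK uE dotZl mulr_gt0 //.
rewrite dotDr dotNr dotZr subr_gt0.
have Ax0 : A *m x != 0.
  apply: contraTneq (A_pos x0) => ->; by rewrite dot0l ltxx.
have := posdef_CauchySchwarz x (A *m x) A_sym A_pos.
have := M_pos Ax0; rewrite mulmxBl mul1mx -scalemxAl dotDl dotNl dotZl subr_gt0.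
set a := dot (A *m x) (A *m x); set s := dot (A *m (A *m x)) _; set r := dot (A *m x) x.
have a0 : 0 < a by rewrite /a -enorm_sqr exprn_gt0 ?enorm_gt0.
have r0 : 0 < r by exact: A_pos.
move=> sa ar; rewrite -(ltr_pM2r a0) -mulrA -expr2.
apply: (@le_lt_trans _ _ (gam * (r * s))); first by rewrite ler_pM2l.
by rewrite mulrCA ltr_pM2l.
Qed.

Definition grad (u : vec) : vec := grad_psi A b gam u (p u).

Definition psi_real (u : vec) : R :=
  1 / 2 * dot (P *m u) u + dot c u + moreau_real g gam p u.

Lemma psi_realE u : psi A b g gam u = (psi_real u)%:E.
Proof. by rewrite /psi (moreauE g_proper g_convex gam_gt0 proxp). Qed.

Lemma grad_diff u v : grad u - grad v = Q *m (u - v) - (p u - p v).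
Proof.
rewrite /grad /grad_psi -/Q -/c mulmxBr; move: (Q *m u) (Q *m v) => a a'.
by apply/matrixP => i j; rewrite !mxE; ring.
Qed.

Lemma gradE u : grad u = P *m u + c + (u - p u).
Proof.
rewrite /grad /grad_psi -/Q -/c PE.
by apply/matrixP => i j; rewrite !mxE; ring.
Qed.

Lemma psi_real_regular : exists lam L : R, [/\ 0 < lam, lam <= L,
  (forall x y, enorm (grad x - grad y) <= L * enorm (x - y)),
  (forall x y, psi_real x + dot (grad x) (y - x) + lam / 2 * dot (y - x) (y - x)
     <= psi_real y) &
  (forall x y, psi_real y <=
     psi_real x + dot (grad x) (y - x) + L / 2 * dot (y - x) (y - x))].
Proof.
have [lam lam0 hlam] := posdef_strong Pm_sym Pm_posdef.
have [CQ CQ0 hQ] := mulmx_bound Q.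
have quad x y : psi_real y = psi_real x + dot (P *m x + c) (y - x)
    + 1 / 2 * dot (P *m (y - x)) (y - x) + moreau_real g gam p y - moreau_real g gam p x.
  rewrite /psi_real -{1 2 3}(subrK x y); move: (y - x) => h.
  by rewrite !mulmxDr !dotE (sym_dot x h Pm_sym) (dotC x (P *m h)); lra.
(* [CQ] bounds [Q], [1] is the Lipschitz constant of [p], and [lam] is added to ensure
   [lam <= L]. *)
exists lam, (CQ + 1 + lam); split=> // [|x y|x y|x y].
- by rewrite lerDr addr_ge0 // ltW.
- rewrite grad_diff (le_trans (enormD _ _)) // enormN.
  have := hQ (x - y).
  have := prox_nonexpansive g_proper g_convex gam_gt0 proxp x y.
  by have := mulr_ge0 (ltW lam0) (enorm_ge0 (x - y)); lra.
- rewrite (quad x y) gradE (dotDl (P *m x + c)).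
  have := moreau_real_ge g_proper g_convex gam_gt0 proxp x y.
  by have := hlam (y - x); lra.
- rewrite (quad x y) gradE (dotDl (P *m x + c)).
  have := moreau_real_le g_proper g_convex gam_gt0 proxp x y.
  have : dot (P *m (y - x)) (y - x) <= CQ * dot (y - x) (y - x) - dot (y - x) (y - x).
    rewrite PE; move: (y - x) => h; rewrite dotDl dotNl lerD2r (le_trans (dot_le _ _)) //.
    by rewrite -enorm_sqr expr2 mulrA ler_wpM2r ?enorm_ge0.
  have := mulr_ge0 (ltW lam0) (dot_ge0 (y - x)).
  by have := dot_ge0 (y - x); lra.
Qed.

(* The graph of [subdiff g] is parametrised by [u |-> (p u, (u - p u) / gam)]. *)
Lemma rnormal_rcoderiv u z1 z2 :
  rnormal (gph_subdiff g) (p u, gam^-1 *: (u - p u)) (z1, z2) <->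
  rcoderiv grad u (z2 + Q *m (gam *: z1 - z2)) (gam *: z1 - z2).
Proof.
pose gr u := (p u, gam^-1 *: (u - p u)).
(* The left side is [<gam z1 - z2, p v - p u> + <z2, v - u>], and [p v - p u = Q (v - u) - (grad v -
   grad u)]. *)
have key v : gam * pdot (z1, z2) (psub (gr v) (gr u)) =
    dot (z2 + Q *m (gam *: z1 - z2)) (v - u) - dot (gam *: z1 - z2) (grad v - grad u).
  rewrite grad_diff /pdot /psub /= dotDl (sym_dot _ _ Q_sym) -scalerBr mulrDr.
  rewrite dotZr mulVKf ?gt_eqF // (_ : v - p v - (u - p u) = v - u - (p v - p u)).
    by move: (v - u) (p v - p u) => a d; rewrite !dotE; ring.
  by apply/matrixP => i j; rewrite !mxE; ring.
have pn v := prox_nonexpansive g_proper g_convex gam_gt0 proxp v u.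
(* With [le2]: the parametrisation is bi-Lipschitz, so remainders small relative to [|v - u|] and
   relative to the distance in the graph agree. *)
have le1 v : enorm (v - u) <= (1 + gam) * pnorm (psub (gr v) (gr u)).
  have := pnorm_fst (psub (gr v) (gr u)); have := pnorm_snd (psub (gr v) (gr u)).
  rewrite /psub /= => /(ler_wpM2l (ltW gam_gt0)) h1 h2.
  rewrite (_ : v - u = (p v - p u) +
      gam *: (gam^-1 *: (v - p v) - gam^-1 *: (u - p u))); last first.
    rewrite -scalerBr scalerA mulfV ?gt_eqF // scale1r.
    by apply/matrixP => i j; rewrite !mxE; ring.
  rewrite mulrDl mul1r (le_trans (enormD _ _)) // lerD //.
  by rewrite enormZ gtr0_norm.
have le2 v : gam * pnorm (psub (gr v) (gr u)) <= (gam + 2) * enorm (v - u).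
  apply: le_trans (ler_wpM2l (ltW gam_gt0) (pnorm_le _)) _.
  rewrite /psub /= -scalerBr enormZ gtr0_norm ?invr_gt0 // mulrDr mulVKf ?gt_eqF //.
  rewrite mulrDl lerD ?ler_pM2l //.
  rewrite (_ : v - p v - (u - p u) = (v - u) - (p v - p u)); last first.
    by apply/matrixP => i j; rewrite !mxE; ring.
  by apply: le_trans (enormD _ _) _; rewrite enormN; have := pn v; lra.
have g2 : 0 < gam + 2 by rewrite addr_gt0.
have g1 : 0 < 1 + gam by rewrite addr_gt0.
split=> [[_ h] e e0|h].
  have [|d [d0 hd]] := h (e / (gam + 2)); first by rewrite divr_gt0.
  exists (d * gam / (gam + 2)) => [|v vd]; first by rewrite !divr_gt0 ?mulr_gt0.
  have [->|vu] := eqVneq v u; first by rewrite !subrr !dot0r enorm0 mulr0 subr0.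
  have vp : 0 < enorm (v - u) by rewrite enorm_gt0 // subr_eq0.
  rewrite -key; have pp : 0 < pnorm (psub (gr v) (gr u)).
    by rewrite -(pmulr_rgt0 _ g1) (lt_le_trans vp).
  have pd : pnorm (psub (gr v) (gr u)) < d.
    rewrite -(ltr_pM2l gam_gt0) (le_lt_trans (le2 v)) //.
    by rewrite [ltRHS]mulrC [ltLHS]mulrC -(ltr_pdivlMr _ _ g2).
  have := hd _ (gph_prox g_proper g_convex gam_gt0 proxp v); rewrite pp pd => /(_ isT).
  move=> /(ler_wpM2l (ltW gam_gt0)) /le_trans; apply.
  rewrite mulrCA (le_trans (ler_wpM2l _ (le2 v))) ?divr_ge0 ?(ltW e0) ?(ltW g2) //.
  by rewrite mulrA divfK ?gt_eqF.
split; first exact: (gph_prox g_proper g_convex gam_gt0 proxp).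
move=> e e0; have [|d d0 hd] := h (gam * e / (1 + gam)).
  by rewrite divr_gt0 ?mulr_gt0.
exists (d / (1 + gam)); split=> [|[x y] xy /andP[_]]; first by rewrite divr_gt0.
have -> : (x, y) = gr (x + gam *: y).
  have /(gph_subdiff_prox g_proper g_convex gam_gt0 proxp) h1 := xy.
  rewrite /gr h1 addrAC subrr add0r scalerA mulVf ?gt_eqF // scale1r //.
move: (x + gam *: y) => v; rewrite ltr_pdivlMr // mulrC => pd.
rewrite -(ler_pM2l gam_gt0) key (le_trans (hd _ (le_lt_trans (le1 v) pd))) //.
apply: le_trans (ler_wpM2l _ (le1 v)) _.
  by rewrite divr_ge0 ?mulr_ge0 ?(ltW g1) ?(ltW gam_gt0) ?(ltW e0).
by rewrite mulrA divfK ?gt_eqF // mulrA.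
Qed.

Lemma rcoderiv_rnormal u w y : rcoderiv grad u w y ->
  rnormal (gph_subdiff g) (p u, gam^-1 *: (u - p u))
    (gam^-1 *: (w - P *m y), w - Q *m y).
Proof.
move=> h; apply/rnormal_rcoderiv.
have -> : gam *: (gam^-1 *: (w - P *m y)) - (w - Q *m y) = y.
  rewrite scalerA mulfV ?gt_eqF // scale1r PE.
  by apply/matrixP => i j; rewrite !mxE; ring.
by rewrite subrK.
Qed.

Let p_lip x y : enorm (p x - p y) <= 1 * enorm (x - y).
Proof. by rewrite mul1r (prox_nonexpansive g_proper g_convex gam_gt0 proxp). Qed.

(** The change of variables of [rnormal_rcoderiv] sends the normal
    [(gam^-1 (- F u - P d), - (Q d + F u))] to the pair [(- F u, d)], because [Q d - P d = d]; being
    linear and invertible, it respects limits. *)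
Lemma newton_dir_lcoderiv u d :
  newton_dir A b g gam u (p u) d <-> lcoderiv grad u (- grad u) d.
Proof.
rewrite /newton_dir /subdiff2 /= -/(grad u) -/Q -/P; split.
  move=> [z [w [hz [/pcvgP[/= z1 z2] [/pcvgP[/= w1 w2] h]]]]].
  have cy : vcvg (fun k => gam *: (w k).1 - (w k).2) d.
    have -> : d = gam *: (gam^-1 *: (- grad u - P *m d)) - - (Q *m d + grad u).
      rewrite scalerA mulfV ?gt_eqF // scale1r PE.
      by apply/matrixP => i j; rewrite !mxE; ring.
    apply: vcvgD; last exact: vcvgN.
    by apply: vcvgZ => //; exact: cvg_cst.
  exists (fun k => (z k).1 + gam *: (z k).2),
    (fun k => (w k).2 + Q *m (gam *: (w k).1 - (w k).2)),
    (fun k => gam *: (w k).1 - (w k).2); split=> //.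
  - have -> : u = p u + gam *: (gam^-1 *: (u - p u)).
      by rewrite scalerA mulfV ?gt_eqF // scale1r addrC subrK.
    by apply: vcvgD => //; apply: vcvgZ => //; exact: cvg_cst.
  - have -> : - grad u = - (Q *m d + grad u) + Q *m d.
      by move: (grad u) => f; rewrite opprD addrAC addNr add0r.
    by apply: vcvgD => //; exact: vcvg_mulmx.
  - move=> k; apply/rnormal_rcoderiv.
    have /(gph_subdiff_prox g_proper g_convex gam_gt0 proxp) e1 :
        gph_subdiff g ((z k).1, (z k).2).
      by have := hz k; case: (z k).
    rewrite e1 (_ : gam^-1 *: _ = (z k).2); last first.
      by rewrite addrAC subrr add0r scalerA mulVf ?gt_eqF // scale1r.
    by have := h k; case: (z k) => ? ?; case: (w k).
move=> [xs [ws [ys [hx hw hy h]]]].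
exists (fun k => (p (xs k), gam^-1 *: (xs k - p (xs k)))),
  (fun k => (gam^-1 *: (ws k - P *m ys k), ws k - Q *m ys k)).
have hp : vcvg (fun k => p (xs k)) (p u) := vcvg_lip p_lip hx.
split; first by move=> k; exact: (gph_prox g_proper g_convex gam_gt0 proxp).
split.
  apply/pcvgP; split=> //=; apply: vcvgZ; first exact: cvg_cst.
  by apply: vcvgD => //; exact: vcvgN.
split; last by move=> k; exact: rcoderiv_rnormal.
apply/pcvgP; split=> /=.
  apply: vcvgZ; first exact: cvg_cst.
  by apply: vcvgD => //; apply: vcvgN; exact: vcvg_mulmx.
rewrite opprD addrC; apply: vcvgD => //.
by apply: vcvgN; exact: vcvg_mulmx.
Qed.

(** The definition speaks of one direction at a time; uniformity comes from compactness. A violating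
    sequence, scaled by [|x k - ub|] and by the norm of its argument [y], has a subsequence
    converging to a directional normal that contradicts the definition. *)
Lemma grad_semismooth ub (lam L : R) : 0 < lam -> lam <= L ->
  (forall x y, enorm (grad x - grad y) <= L * enorm (x - y)) -> grad ub = 0 ->
  semismooth_star_subdiff g (p ub) (gam^-1 *: (ub - p ub)) ->
  forall e : R, 0 < e -> exists2 d : R, 0 < d &
    forall x w y, enorm (x - ub) < d -> rcoderiv grad x w y ->
      `|dot w (x - ub) - dot y (grad x)| <= e * (enorm (x - ub) * enorm y).
Proof.
move=> lam0 lamL F_lip Fub ss e e0; apply: contrapT => hn.
have hk (k : nat) : exists s : vec * vec * vec,
    [/\ enorm (s.1.1 - ub) <= k.+1%:R^-1, rcoderiv grad s.1.1 s.1.2 s.2 &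
      e * (enorm (s.1.1 - ub) * enorm s.2) <
      `|dot s.1.2 (s.1.1 - ub) - dot s.2 (grad s.1.1)|].
  apply: contrapT => hk; apply: hn; exists k.+1%:R^-1; first by rewrite invr_gt0.
  move=> x w y xk hr; rewrite leNgt; apply/negP => hl; apply: hk.
  by exists (x, w, y); split=> //; exact: ltW.
have [s hs] := choice hk.
pose x k := (s k).1.1; pose t k := enorm (x k - ub); pose a k := enorm (s k).2.
(* Strictness of the violation excludes [x k = ub] and [y = 0] (which forces [w = 0]): both sides
   would vanish. *)
have t0 k : 0 < t k.
  apply: enorm_gt0; have [_ _ +] := hs k; apply: contraTneq.
  move=> /[dup] xu /eqP; rewrite subr_eq0 => /eqP xE.
  by rewrite -/(x k) xu xE Fub !dot0r subrr normr0 enorm0 mul0r mulr0 ltxx.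
have a0 k : 0 < a k.
  apply: enorm_gt0; have [_ hr +] := hs k; apply: contraTneq => y0.
  have := rcoderiv_le lam0 lamL F_lip hr; rewrite y0 enorm0 mulr0 => w0.
  have -> : (s k).1.2 = 0 by apply: enorm_eq0; apply/eqP; rewrite eq_le w0 enorm_ge0.
  by rewrite !dot0l subrr normr0 !mulr0 ltxx.
pose Y k := (a k)^-1 *: (s k).2; pose W k := (a k)^-1 *: (s k).1.2.
pose h k := (t k)^-1 *: (x k - ub); pose q k := (t k)^-1 *: (p (x k) - p ub).
have hr k : rcoderiv grad (x k) (W k) (Y k).
  by apply: rcoderivZ; [rewrite invr_gt0|have [] := hs k].
have xE k : x k - ub = t k *: h k by rewrite /h scalerA mulfV ?gt_eqF // scale1r.
have qE k : p (x k) - p ub = t k *: q k by rewrite /q scalerA mulfV ?gt_eqF // scale1r.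
have big k : e <= `|dot (W k) (h k) - dot (Y k) (Q *m h k - q k)|.
  have [_ _ +] := hs k; rewrite -/(x k) -/(t k) -/(a k).
  have -> : grad (x k) = t k *: (Q *m h k - q k).
    by rewrite -[LHS]subr0 -Fub grad_diff scalerBr scalemxAr -xE -qE.
  have -> : (s k).2 = a k *: Y k by rewrite /Y scalerA mulfV ?gt_eqF // scale1r.
  have -> : (s k).1.2 = a k *: W k by rewrite /W scalerA mulfV ?gt_eqF // scale1r.
  rewrite xE; move: (W k) (Y k) (h k) (q k) => W1 Y1 h1 q1.
  rewrite !dotZl !dotZr -!mulrBr !normrM (gtr0_norm (a0 k)) (gtr0_norm (t0 k)).
  rewrite [ltRHS]mulrA [a k * t k]mulrC [ltLHS]mulrC.
  by rewrite (ltr_pM2l (mulr_gt0 (t0 k) (a0 k))) => /ltW.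
have h1 k : enorm (h k) <= 1.
  by rewrite /h enormZ gtr0_norm ?invr_gt0 // mulVf ?gt_eqF.
have q1 k : enorm (q k) <= 1.
  rewrite /q enormZ gtr0_norm ?invr_gt0 // mulrC ler_pdivrMr //; exact: p_lip.
have Y1 k : enorm (Y k) <= 1.
  by rewrite /Y enormZ gtr0_norm ?invr_gt0 // mulVf ?gt_eqF.
have W1 k : enorm (W k) <= L.
  apply: le_trans (rcoderiv_le lam0 lamL F_lip (hr k)) _.
  by rewrite ler_piMr // (le_trans (ltW lam0)).
have [f1 [hb [ff1 c1]]] := bounded_subseq h1.
have [f2 [qb [ff2 c2]]] := bounded_subseq (fun k => q1 (f1 k)).
have [f3 [Yb [ff3 c3]]] := bounded_subseq (fun k => Y1 (f1 (f2 k))).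
have [f4 [Wb [ff4 c4]]] := bounded_subseq (fun k => W1 (f1 (f2 (f3 k)))).
have ff23 k : (k <= f2 (f3 (f4 k)))%N.
  exact: leq_trans (ff4 _) (leq_trans (ff3 _) (ff2 _)).
have ff34 k : (k <= f3 (f4 k))%N by exact: leq_trans (ff4 _) (ff3 _).
pose f k := f1 (f2 (f3 (f4 k))).
have ff k : (k <= f k)%N by exact: leq_trans (ff23 _) (ff1 _).
have hc : vcvg (fun k => h (f k)) hb by exact: (vcvg_sub ff23 c1).
have qc : vcvg (fun k => q (f k)) qb by exact: (vcvg_sub ff34 c2).
have Yc : vcvg (fun k => Y (f k)) Yb by exact: (vcvg_sub ff4 c3).
have Wc : vcvg (fun k => W (f k)) Wb by exact: c4.
have : dnormal (gph_subdiff g) (p ub, gam^-1 *: (ub - p ub))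
    (qb, gam^-1 *: (hb - qb)) (gam^-1 *: (Wb - P *m Yb), - (Q *m Yb - Wb)).
  exists (fun k => t (f k)), (fun k => (q (f k), gam^-1 *: (h (f k) - q (f k)))),
    (fun k => (gam^-1 *: (W (f k) - P *m Y (f k)), W (f k) - Q *m Y (f k))).
  split; [|split; [|split]].
  - split=> [k|]; first exact: t0.
    apply/rcvgP; apply: (@squeeze_cvgr _ _ _ _ (fun=> 0) (@harmonic R)).
    + apply: nearW => k; rewrite (ltW (t0 _)) /=.
      have [h2 _ _] := hs (f k); apply: le_trans h2 _.
      by rewrite lef_pV2 ?posrE // ler_nat ltnS.
    + exact: cvg_cst.
    + exact: cvg_harmonic.
  - apply/pcvgP; split=> //=; apply: vcvgZ; first exact: cvg_cst.
    by apply: vcvgD => //; exact: vcvgN.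
  - apply/pcvgP; split=> /=.
      apply: vcvgZ; first exact: cvg_cst.
      by apply: vcvgD => //; apply: vcvgN; exact: vcvg_mulmx.
    rewrite opprB; apply: vcvgD => //.
    by apply: vcvgN; exact: vcvg_mulmx.
  - move=> k; rewrite /padd /pscale /=.
    have -> : p ub + t (f k) *: q (f k) = p (x (f k)) by rewrite -qE addrC subrK.
    have -> : gam^-1 *: (ub - p ub) + t (f k) *: (gam^-1 *: (h (f k) - q (f k))) =
        gam^-1 *: (x (f k) - p (x (f k))).
      rewrite scalerA (mulrC (t _)) -scalerA -scalerDr scalerBr -xE -qE.
      by congr (_ *: _); move: (x (f k)) => v; apply/matrixP => i j; rewrite !mxE; ring.
    exact: rcoderiv_rnormal.
move=> /ss; rewrite dotZl dotZr => /(mulfI (invr_neq0 (lt0r_neq0 gam_gt0))) E.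
have : e <= `|dot Wb hb - dot Yb (Q *m hb - qb)|.
  have c5 : (fun k => `|dot (W (f k)) (h (f k)) - dot (Y (f k)) (Q *m h (f k) - q (f k))|)
      @ \oo --> `|dot Wb hb - dot Yb (Q *m hb - qb)|.
    apply: cvg_norm; apply: cvgB; first exact: dot_cvg.
    apply: dot_cvg => //; apply: vcvgD; first exact: vcvg_mulmx.
    exact: vcvgN.
  by apply: (cvgr_to_ge c5); apply: nearW => k; exact: big.
rewrite (_ : dot Wb hb - _ = 0) ?normr0 ?leNgt ?e0 //.
move: E; rewrite PE !dotE (sym_dot _ _ Q_sym) (sym_dot _ _ Q_sym); lra.
Qed.

End Problem.

(** * Unique solution and tilt stability *)

Section QuadraticComposite.
Variables (R : realType) (n : nat).
Notation vec := 'cV[R]_n.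
Variables (A : 'M[R]_n) (b : vec) (alpha : R) (g : vec -> \bar R).
Hypothesis A_sym : sym_mx A.
Hypothesis A_pos : posdef A.
Hypothesis g_proper : proper_fun g.
Hypothesis g_lsc : lsc_fun g.
Hypothesis g_convex : convex_fun g.

(** The tilt [- <v, x>] is absorbed into the quadratic part, so the composite results apply to every
    tilted problem. *)
Let f (v x : vec) : R := 1 / 2 * dot (A *m x) x + dot b x + alpha - dot v x.
Let G (v x : vec) : vec := A *m x + b - v.

Let fE v x y : f v y = f v x + dot (G v x) (y - x) + 1 / 2 * dot (A *m (y - x)) (y - x).
Proof.
rewrite /f /G -{1 2 3 4}(subrK x y); move: (y - x) => h.
by rewrite !mulmxDr !dotE (sym_dot x h A_sym) (dotC x (A *m h)); lra.
Qed.

Let phiE v x : (phi A b alpha g x - (dot v x)%:E = (f v x)%:E + g x)%E.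
Proof. by rewrite /phi /f EFinB addeAC. Qed.

Lemma phi_minimizers : exists2 lam : R, 0 < lam & forall v, exists x,
  [/\ forall y, (phi A b alpha g x - (dot v x)%:E <= phi A b alpha g y - (dot v y)%:E)%E,
      forall x', (forall y, (phi A b alpha g x' - (dot v x')%:E
         <= phi A b alpha g y - (dot v y)%:E)%E) -> x' = x,
      subdiff g x (v - A *m x - b) &
      forall v' x', subdiff g x' (v' - A *m x' - b) ->
        lam * enorm (x - x') <= enorm (v - v')].
Proof.
have [lam lam0 hlam] := posdef_strong A_sym A_pos.
have [C C0 hC] := mulmx_bound A.
have a0 : 0 < lam / 2 by rewrite divr_gt0.
have f_ge v x y : f v x + dot (G v x) (y - x) + lam / 2 * dot (y - x) (y - x) <= f v y.
  by rewrite (fE v x y); have := hlam (y - x); lra.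
have f_le v x y : f v y <= f v x + dot (G v x) (y - x) + C / 2 * dot (y - x) (y - x).
  rewrite (fE v x y) lerD2l.
  have : dot (A *m (y - x)) (y - x) <= C * dot (y - x) (y - x); last by lra.
  apply: le_trans (dot_le _ _) _.
  by rewrite -enorm_sqr expr2 mulrA ler_wpM2r ?enorm_ge0.
exists lam => // v.
have [x hx] := composite_min_exists g_proper g_lsc g_convex a0 (f_ge v).
have NG y : - G v y = v - A *m y - b by rewrite /G opprB opprD addrA.
have sx : subdiff g x (v - A *m x - b).
  by rewrite -NG; apply/(composite_minP g_proper g_convex a0 (f_ge v) (f_le v)).
exists x; split=> [y|x' hx'| //|v' x' sx'].
- by rewrite !phiE; exact: hx.
- apply: (composite_min_unique g_proper g_convex a0 (f_ge v) (f_le v)) hx => y.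
  by have := hx' y; rewrite !phiE.
have [->|xx] := eqVneq x x'; first by rewrite subrr enorm0 mulr0 enorm_ge0.
have xp : 0 < enorm (x - x') by rewrite enorm_gt0 // subr_eq0.
rewrite -(ler_pM2r xp) -mulrA -expr2 enorm_sqr.
apply: le_trans (hlam (x - x')) _; apply: le_trans _ (dot_le _ _).
have := subdiff_mono sx sx'.
rewrite (_ : v - A *m x - b - _ = v - v' - A *m (x - x')); last first.
  rewrite mulmxBr; move: (A *m x) (A *m x') => p p'.
  by apply/matrixP => i j; rewrite !mxE; ring.
by rewrite (dotDl (v - v')) dotNl subr_ge0.
Qed.

Lemma phi_solution : exists xb : vec,
  [/\ [set x | forall y, (phi A b alpha g x <= phi A b alpha g y)%E] = [set xb],
      tilt_stable (phi A b alpha g) xb & subdiff g xb (- (A *m xb) - b)].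
Proof.
have [lam lam0 h] := phi_minimizers; have [m hm] := choice h.
have dot0E (x : vec) : (phi A b alpha g x - (dot 0 x)%:E = phi A b alpha g x)%E.
  by rewrite dot0l sube0.
have lip v v' : lam * enorm (m v - m v') <= enorm (v - v').
  have [_ _ _ hv] := hm v; have [_ _ hv' _] := hm v'; exact: hv hv'.
exists (m 0); split; last by have [_ _ + _] := hm 0; rewrite sub0r.
  apply/seteqP; split=> [x hx|_ -> y] /=.
    by have [_ + _ _] := hm 0; apply => y; rewrite !dot0E; exact: hx.
  by have [/(_ y) + _ _ _] := hm 0; rewrite !dot0E.
(* Tilts shorter than [lam] keep [m v] within distance 1 of [m 0], so the minimiser over the unit
   ball is the global one. *)
exists 1; split=> //; exists lam, lam^-1, m; split=> //; split; last split=> //.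
  move=> v vl; have [h1 h2 _ _] := hm v.
  have mb : enorm (m v - m 0) <= 1.
    rewrite -(ler_pM2l lam0) mulr1 (le_trans (lip v 0)) //.
    by rewrite subr0 ltW.
  apply/seteqP; split=> [x [_ hx]|_ ->] /=; last by split=> // y _; exact: h1.
  by apply: h2 => y; apply: le_trans (hx _ mb) (h1 y).
move=> v v' _ _; rewrite mulrC ler_pdivlMr // mulrC; exact: lip.
Qed.

End QuadraticComposite.

Theorem theorem5p12 (R : realType) (n : nat) (A : 'M[R]_n) (b : 'cV[R]_n) (alpha : R)
    (g : 'cV[R]_n -> \bar R) (sigma beta gam : R) :
  sym_mx A -> posdef A ->
  proper_fun g -> lsc_fun g -> convex_fun g ->
  0 < sigma < 1 / 2 -> 0 < beta < 1 ->
  0 < gam -> posdef (1%:M - gam *: A) ->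
  (* (i) well-definedness of the algorithm *)
  (forall u : 'cV[R]_n, exists! v, prox g gam u v) /\
  (forall u v : 'cV[R]_n, prox g gam u v -> grad_psi A b gam u v != 0 ->
     (exists d, newton_dir A b g gam u v d) /\
     (forall d, newton_dir A b g gam u v d -> exists j, armijo A b g gam sigma beta u v d j)) /\
  (forall u0 : 'cV[R]_n, exists u : nat -> 'cV[R]_n,
     u 0%N = u0 /\ gdna_seq A b g gam sigma beta u) /\
  (* (i) convergence, (ii) tilt stability / uniqueness, and superlinear rate *)
  (forall u : nat -> 'cV[R]_n, gdna_seq A b g gam sigma beta u ->
     exists ub : 'cV[R]_n,
       let xb := Qm A gam *m ub + cv A b gam in
       let vb := - (A *m xb) - b in
       vcvg u ub /\ R_linear u ub /\
       tilt_stable (phi A b alpha g) xb /\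
       [set x | forall y, (phi A b alpha g x <= phi A b alpha g y)%E] = [set xb] /\
       (semismooth_star_subdiff g xb vb ->
         (sigma < 1 / (2 * (1 + opnorm (Qm A gam)) * (1 / lambda_min (Pm A gam))))
           \/ twice_epi_diff g xb vb ->
         Q_superlinear u ub)).
Proof.
move=> A_sym A_pos g_proper g_lsc g_convex hsigma hbeta gam0 M_pos.
have [p proxp] := choice (prox_exists g_proper g_lsc g_convex gam0).
have proxE u v : prox g gam u v -> v = p u.
  by move/(prox_unique g_proper g_convex gam0); apply; exact: proxp.
have [lam [L [lam0 lamL F_lip psi_ge psi_le]]] :=
  psi_real_regular b A_sym A_pos g_proper g_convex gam0 M_pos proxp.
have ndE u d := newton_dir_lcoderiv b A_sym g_proper g_convex gam0 proxp u d.
pose F := grad A b gam p; pose ps := psi_real A b g gam p.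
have armE u d j : armijo A b g gam sigma beta u (p u) d j <->
    armijo_test F ps sigma beta u d j.
  by rewrite /armijo !(psi_realE A b g_proper g_convex gam0 proxp) -EFinD lee_fin.
have stepP u u' : gdna_step A b g gam sigma beta u u' ->
    damped_newton_step F ps sigma beta u u'.
  move=> [v [/proxE -> [[Fu ->]|[_ [d [j [hd [hj [hi ->]]]]]]]]]; first by left.
  right; exists d, j; split=> //; [exact/ndE|exact/armE|].
  by move=> i ij /armE; exact: hi.
split; first by move=> u; exists (p u); split=> // v /proxE.
split.
  move=> u v /proxE -> Fu; split.
    have [d hd] := lcoderiv_exists lam0 lamL F_lip psi_ge u (- F u).
    by exists d; apply/ndE.
  move=> d /ndE hd.
  have [j hj] := armijo_exists lam0 lamL psi_ge psi_le hsigma hbeta hd.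
  by exists j; apply/armE.
split.
  move=> u0; have hs u : exists u', gdna_step A b g gam sigma beta u u'.
    have [Fu|Fu] := eqVneq (F u) 0; first by exists u, (p u); split=> //; left.
    have [u' hu'] :=
      damped_newton_step_exists lam0 lamL F_lip psi_ge psi_le hsigma hbeta u.
    exists u', (p u); split=> //; right; split=> //.
    case: hu' => [[/eqP]|[d [j [hd hj hi ->]]]]; first by rewrite (negPf Fu).
    exists d, j; split; [exact/ndE|split; [exact/armE|split=> //]].
    by move=> i ij /armE; exact: hi.
  have [s hs'] := choice hs.
  by exists (fun k => iter k s u0); split=> // k; rewrite iterS; exact: hs'.
move=> u hu.
have [xb [sol tilt sub]] := phi_solution b alpha A_sym A_pos g_proper g_lsc g_convex.
(* As [vb] is a subgradient at [xb], Minty's parametrisation gives [p ub = xb]; moreover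
   [ub = (1 - gam A) xb - gam b], whence [Q ub + c = xb]. *)
pose vb := - (A *m xb) - b; pose ub := xb + gam *: vb.
have pub : p ub = xb by apply/(gph_subdiff_prox g_proper g_convex gam0 proxp).
have xbE : Qm A gam *m ub + cv A b gam = xb.
  have -> : ub = (1%:M - gam *: A) *m xb - gam *: b.
    by rewrite /ub /vb mulmxBl mul1mx -scalemxAl scalerBr scalerN addrA.
  rewrite mulmxBr mulKmx ?posdef_unitmx // /cv -scalemxAr subrK //.
have Fub : F ub = 0 by rewrite /F /grad /grad_psi pub addrAC xbE subrr.
have vbE : vb = gam^-1 *: (ub - p ub).
  by rewrite pub /ub addrAC subrr add0r scalerA mulVf ?gt_eqF // scale1r.
have ustep k : damped_newton_step F ps sigma beta (u k) (u k.+1) by exact/stepP/hu.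
exists ub; rewrite xbE /=; split.
  exact: (damped_newton_cvg lam0 lamL F_lip psi_ge psi_le Fub hsigma hbeta ustep).
split.
  exact: (damped_newton_linear lam0 lamL F_lip psi_ge psi_le Fub hsigma hbeta ustep).
split=> //; split=> // ss _.
apply: (damped_newton_superlinear lam0 lamL F_lip psi_ge psi_le Fub hsigma hbeta ustep).
apply: (grad_semismooth A_sym g_proper g_convex gam0 proxp lam0 lamL F_lip Fub).
by rewrite -vbE pub.
Qed.
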